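(* Let $(A,B)$ be a tri-diagonal system and let $k$ be a positive integer. Assume that the sequence $\left(\frac{\lambda_{n+1}}{\lambda_n}\right)_{n\in\mathbf{N}}$ is bounded, that the sequences $\left(\frac{b_{n,n-1}}{\lambda_n}\right)_n$ and $\left(\frac{b_{n,n}}{\lambda_n}\right)_n$ tend to zero, and that the sequence $\left(|b_{n,n+1}|\left(\frac{\lambda_{n+1}^k}{\lambda_n^k}-1\right)\right)_{n\in\mathbf{N}}$ is bounded. Then $(A,B)$ is $k$-weakly-coupled with coupling constant $$c_k(A,B)\le\sup_n|b_{n,n+1}|\left(\frac{\lambda_{n+1}^k}{\lambda_n^k}-1\right).$$
   Context: $H$ is a separable complex Hilbert space with inner product $\langle\cdot,\cdot\rangle$ (linear in the second argument); $\mathbf{N}=\{1,2,\ldots\}$. $(A,B)$ is a pair of linear operators in $H$ such that: (i) for every $u\in\mathbf{R}$, $A+uB$ is essentially skew-adjoint on the domain $D(A)$ of $A$, and $\mathrm{i}(A+uB)$ is bounded from below; (ii) $A$ is skew-adjoint with purely discrete spectrum $(-\mathrm{i}\lambda_j)_{j\in\mathbf{N}}$, where $(\lambda_j)_{j\in\mathbf{N}}$ is positive, non-decreasing and unbounded. $(\phi_j)_{j\in\mathbf{N}}$ is a Hilbert basis of $H$ with $A\phi_j=-\mathrm{i}\lambda_j\phi_j$, and $b_{j,k}=\langle\phi_j,B\phi_k\rangle$ (sequences involving $b_{n,n-1}$ are indexed by $n\ge2$). $A+uB$ also denotes its skew-adjoint closure. A pair $(A,B)$ satisfying (i)–(ii)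 is a tri-diagonal system if $|j-k|>1$ implies $b_{j,k}=0$. For $s\ge0$, $D(|A|^s)=\{\psi\in H:\sum_j\lambda_j^{2s}|\langle\phi_j,\psi\rangle|^2<\infty\}$ and $|A|^s\psi=\sum_j\lambda_j^s\langle\phi_j,\psi\rangle\phi_j$; powers of the modulus of other skew-adjoint operators are defined likewise by functional calculus. For $k>0$, $(A,B)$ is $k$-weakly-coupled if for every $u\in\mathbf{R}$, $D(|A+uB|^{k/2})=D(|A|^{k/2})$, and there is a constant $C$ such that $|\Re\langle|A|^k\psi,B\psi\rangle|\le C|\langle|A|^k\psi,\psi\rangle|$ for every $\psi\in D(|A|^k)$. The coupling constant is $c_k(A,B)=\sup_{\psi\in D(|A|^k)\setminus\{0\}}\frac{|\Re\langle|A|^k\psi,B\psi\rangle|}{|\langle|A|^k\psi,\psi\rangle|}$. *)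

(* Defs.v *)
From HB Require Import structures.
From mathcomp Require Export all_boot all_order all_algebra.
From mathcomp Require Export all_classical all_reals all_analysis.
From mathcomp Require Export complex.
Set Implicit Arguments.
Unset Strict Implicit.
Unset Printing Implicit Defensive.
Import Order.TTheory GRing.Theory Num.Theory.
Import numFieldNormedType.Exports.
Import ComplexField.
Local Open Scope classical_set_scope.
Local Open Scope ring_scope.
Local Open Scope complex_scope.

(* The library's [{dot H for conjC}] is linear in its first argument; here the
   inner product is linear in the second one, hence the swap. *)
Definition inner (R : realType) (H : completeNormedModType R[i])
    (dot : {dot H for Num.conj}) (x y : H) : R[i] := dot y x.

(* [H], with its norm and completeness, is a Hilbert space for [dot]. *)
Definition is_hilbert (R : realType) (H : completeNormedModType R[i])
    (dot : {dot H for Num.conj}) : Prop :=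
  forall x : H, inner dot x x = `|x| ^+ 2.

Definition separable_space (T : topologicalType) : Prop :=
  exists2 D : set T, countable D & dense D.

(* Unbounded linear operators. The values of [op] outside [dom] are
   irrelevant: nothing is assumed about them. *)
Record operator (R : realType) (H : completeNormedModType R[i]) := Operator {
  dom : set H ;
  op :> H -> H ;
  dom0 : dom 0 ;
  dom_linear : forall (a : R[i]) x y, dom x -> dom y -> dom (a *: x + y) ;
  op_linear : forall (a : R[i]) x y, dom x -> dom y ->
    op (a *: x + y) = a *: op x + op y }.

Definition graph (R : realType) (H : completeNormedModType R[i])
    (T : operator H) : set (H * H) := [set p | dom T p.1 /\ p.2 = T p.1].

Section Perturbation.
Variables (R : realType) (H : completeNormedModType R[i]).
Variables (A B : operator H) (u : R).

Lemma perturb_dom0 : (dom A `&` dom B) 0.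
Proof. by split; exact: dom0. Qed.

Lemma perturb_dom_linear (a : R[i]) x y : (dom A `&` dom B) x ->
  (dom A `&` dom B) y -> (dom A `&` dom B) (a *: x + y).
Proof. by move=> [Ax Bx] [Ay By]; split; exact: dom_linear. Qed.

Lemma perturb_op_linear (a : R[i]) x y : (dom A `&` dom B) x ->
  (dom A `&` dom B) y ->
  A (a *: x + y) + u%:C *: B (a *: x + y) =
  a *: (A x + u%:C *: B x) + (A y + u%:C *: B y).
Proof.
move=> [Ax Bx] [Ay By]; rewrite !op_linear// !scalerDr !scalerA.
by rewrite [u%:C * a]mulrC addrACA.
Qed.

Definition perturb : operator H :=
  Operator perturb_dom0 perturb_dom_linear perturb_op_linear.

End Perturbation.

Definition is_closure (R : realType) (H : completeNormedModType R[i])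
    (S T : operator H) : Prop := graph T = closure (graph S).

Definition adjoint_graph (R : realType) (H : completeNormedModType R[i])
    (dot : {dot H for Num.conj}) (T : operator H) : set (H * H) :=
  [set p | forall y, dom T y -> inner dot p.1 (T y) = inner dot p.2 y].

Definition skew_adjoint (R : realType) (H : completeNormedModType R[i])
    (dot : {dot H for Num.conj}) (T : operator H) : Prop :=
  dense (dom T) /\
  adjoint_graph dot T = [set p | dom T p.1 /\ p.2 = - T p.1].

Definition essentially_skew_adjoint (R : realType)
    (H : completeNormedModType R[i]) (dot : {dot H for Num.conj})
    (S : operator H) : Prop :=
  exists2 T : operator H, is_closure S T & skew_adjoint dot T.

(* [i T] is bounded from below; [<=] in [R[i]] also says that the
   right-hand side is real. *)
Definition i_bounded_below (R : realType) (H : completeNormedModType R[i])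
    (dot : {dot H for Num.conj}) (T : operator H) : Prop :=
  exists m : R, forall x, dom T x ->
    m%:C * `|x| ^+ 2 <= inner dot x ('i%C *: T x).

Definition resolvent_set (R : realType) (H : completeNormedModType R[i])
    (T : operator H) : set R[i] :=
  [set z | exists S : H -> H,
    [/\ forall x, dom T x -> S (z *: x - T x) = x,
        forall y, dom T (S y) /\ z *: S y - T (S y) = y &
        exists M : R, forall y, `|S y| <= M%:C * `|y| ] ].

Definition spectrum (R : realType) (H : completeNormedModType R[i])
    (T : operator H) : set R[i] := ~` resolvent_set T.

Definition finite_multiplicity (R : realType) (H : completeNormedModType R[i])
    (T : operator H) (z : R[i]) : Prop :=
  exists n (e : 'I_n -> H), forall x, dom T x -> T x = z *: x ->
    exists c : 'I_n -> R[i], x = \sum_(i < n) c i *: e i.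

(* The repetition of each eigenvalue according to its multiplicity is encoded
   by the Hilbert basis of eigenvectors in [quantum_system]. *)
Definition purely_discrete_spectrum (R : realType)
    (H : completeNormedModType R[i]) (T : operator H) (ev : nat -> R[i])
    : Prop :=
  [/\ spectrum T = range ev,
      forall z, spectrum T z -> exists2 e : R, 0 < e &
        forall w, spectrum T w -> w != z -> e%:C <= `|w - z| &
      forall z, spectrum T z -> finite_multiplicity T z].

Definition hilbert_basis (R : realType) (H : completeNormedModType R[i])
    (dot : {dot H for Num.conj}) (phi : nat -> H) : Prop :=
  (forall j k, inner dot (phi j) (phi k) = (j == k)%:R) /\
  dense [set x : H | exists n (c : 'I_n -> R[i]),
                       x = \sum_(j < n) c j *: phi j].

(* Sequences indexed by {1, 2, ...} are shifted to [nat]: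
   [lam j] and [phi j] stand for lambda_(j+1) and phi_(j+1). *)
Record quantum_system (R : realType) (H : completeNormedModType R[i])
    (dot : {dot H for Num.conj}) (A B : operator H)
    (lam : nat -> R) (phi : nat -> H) : Prop := {
  qs_dom : dom A `<=` dom B ;
  qs_esa : forall u : R, essentially_skew_adjoint dot (perturb A B u) ;
  qs_below : forall u : R, i_bounded_below dot (perturb A B u) ;
  qs_skew : skew_adjoint dot A ;
  qs_spectrum : purely_discrete_spectrum A (fun j => - 'i%C * (lam j)%:C) ;
  qs_lam_gt0 : forall j, 0 < lam j ;
  qs_lam_nd : nondecreasing_seq lam ;
  qs_lam_unbounded : ~ has_ubound (range lam) ;
  qs_basis : hilbert_basis dot phi ;
  qs_phi_dom : forall j, dom A (phi j) ;
  qs_eigen : forall j, A (phi j) = (- 'i%C * (lam j)%:C) *: phi j }.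

Definition coupling (R : realType) (H : completeNormedModType R[i])
    (dot : {dot H for Num.conj}) (B : operator H) (phi : nat -> H)
    (j k : nat) : R[i] := inner dot (phi j) (B (phi k)).

Definition tri_diagonal_system (R : realType) (H : completeNormedModType R[i])
    (dot : {dot H for Num.conj}) (A B : operator H)
    (lam : nat -> R) (phi : nat -> H) : Prop :=
  quantum_system dot A B lam phi /\
  forall j k : nat, (1 < `|j%:Z - k%:Z|%N)%N -> coupling dot B phi j k = 0.

Definition dom_abs_pow (R : realType) (H : completeNormedModType R[i])
    (dot : {dot H for Num.conj}) (lam : nat -> R) (phi : nat -> H) (s : R)
    : set H :=
  [set x | (\sum_(0 <= j <oo)
     (lam j `^ (2 * s) * Normc.normc (inner dot (phi j) x) ^+ 2)%:E < +oo)%E].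

Definition abs_pow (R : realType) (H : completeNormedModType R[i])
    (dot : {dot H for Num.conj}) (lam : nat -> R) (phi : nat -> H) (s : R)
    (x : H) : H :=
  limn (fun n : nat =>
    \sum_(j < n) ((lam j `^ s)%:C * inner dot (phi j) x) *: phi j).

(* Projection-valued measures on the Borel sets of the real line: [pvm_mu x] is
   the measure S |-> <x, E(S) x>. The values of [pvm_E] and [pvm_mu] on
   non-Borel sets are irrelevant. *)
Record pvm (R : realType) (H : completeNormedModType R[i])
    (dot : {dot H for Num.conj}) := PVM {
  pvm_E :> set (measurableTypeR R) -> H -> H ;
  pvm_mu : H -> {measure set (measurableTypeR R) -> \bar R} ;
  pvm_linear : forall S, measurable S -> forall (a : R[i]) x y,
    pvm_E S (a *: x + y) = a *: pvm_E S x + pvm_E S y ;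
  pvm_sym : forall S, measurable S -> forall x y,
    inner dot x (pvm_E S y) = inner dot (pvm_E S x) y ;
  pvm_setT : forall x, pvm_E setT x = x ;
  pvm_setI : forall S S', measurable S -> measurable S' -> forall x,
    pvm_E (S `&` S') x = pvm_E S (pvm_E S' x) ;
  pvm_muE : forall S, measurable S -> forall x,
    pvm_mu x S = (complex.Re (inner dot x (pvm_E S x)))%:E }.

(* [E] is the spectral measure of the self-adjoint operator [- i T], that is
   T = i \int t dE(t): the domain of T is {x | \int t^2 d<x, E(t) x> < oo} and
   <x, T x> = i \int t d<x, E(t) x> on it, which determines T by
   polarization. *)
Definition spectral_measure (R : realType) (H : completeNormedModType R[i])
    (dot : {dot H for Num.conj}) (T : operator H) (E : pvm dot) : Prop :=
  dom T = [set x | (\int[pvm_mu E x]_t (t ^+ 2)%:E < +oo)%E] /\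
  forall x, dom T x ->
    inner dot x (T x) = 'i%C * (Rintegral (pvm_mu E x) setT id)%:C.

(* The domain of |T|^s, for T = i \int t dE(t). *)
Definition spectral_dom_abs_pow (R : realType) (H : completeNormedModType R[i])
    (dot : {dot H for Num.conj}) (E : pvm dot) (s : R) : set H :=
  [set x | (\int[pvm_mu E x]_t (`|t| `^ (2 * s))%:E < +oo)%E].

(* In the first clause [T] is the skew-adjoint closure of A + uB and [E] its
   spectral measure: both exist and are unique, the former by
   [qs_esa] and the latter by the spectral theorem. In the second clause,
   [B x] is only meaningful for x in [dom B]; for k >= 1 this is automatic,
   since D(|A|^k) is then contained in D(A), hence in [dom B]. *)
Definition weakly_coupled (R : realType) (H : completeNormedModType R[i])
    (dot : {dot H for Num.conj}) (A B : operator H)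
    (lam : nat -> R) (phi : nat -> H) (k : R) : Prop :=
  (forall (u : R) (T : operator H) (E : pvm dot),
     is_closure (perturb A B u) T -> spectral_measure T E ->
     spectral_dom_abs_pow E (k / 2) = dom_abs_pow dot lam phi (k / 2)) /\
  (exists C : R, forall x, dom_abs_pow dot lam phi k x ->
     `|complex.Re (inner dot (abs_pow dot lam phi k x) (B x))| <=
     C * Normc.normc (inner dot (abs_pow dot lam phi k x) x)).

Definition coupling_constant (R : realType) (H : completeNormedModType R[i])
    (dot : {dot H for Num.conj}) (B : operator H)
    (lam : nat -> R) (phi : nat -> H) (k : R) : \bar R :=
  ereal_sup [set
    (`|complex.Re (inner dot (abs_pow dot lam phi k x) (B x))| /
     Normc.normc (inner dot (abs_pow dot lam phi k x) x))%:E
    | x in dom_abs_pow dot lam phi k `\ 0].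

(* Main.v *)
Require Import Defs.
From mathcomp Require Import all_boot all_order all_algebra.
From mathcomp Require Import all_classical all_reals all_analysis.
From mathcomp Require Import complex.
From mathcomp Require Import measurable_realfun.
From mathcomp Require Import zify ring lra.
Set Implicit Arguments.
Unset Strict Implicit.
Unset Printing Implicit Defensive.
Import Order.TTheory GRing.Theory Num.Theory.
Import numFieldNormedType.Exports.
Import ComplexField.
Local Open Scope classical_set_scope.
Local Open Scope ring_scope.
Local Open Scope complex_scope.

(** Write [H^s] for the domain of [|A|^s], a weighted space of coordinates in the
    basis [phi], and [T] for the closure of [A + u B]. The hypotheses on the
    matrix of [B], together with the bound on [lam n.+1 / lam n] and the
    skewness of [B], say that its three diagonals are [o(lam n)]: [B] is
    infinitesimally small with respect to [A]. Moreover neighbouring weights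
    [lam n `^ s] are comparable, so that a tri-diagonal matrix acts on weighted
    spaces as if it were diagonal.

    Equality of the domains of [|T|^(k/2)] and [|A|^(k/2)]. On the side of [A],
    [x] belongs to [H^(s+1)] if and only if [x] is in the domain of [T] and [T x]
    is in [H^s] ([Hs_succ]); the direction that gains regularity is an
    absorption argument on weighted sums ([tridiagonal_regularity]). On the side
    of [T], the same statement with the domains of [|T|^s] in place of [H^s] is
    a consequence of the spectral measure ([spectral_dom_succ]): [T] commutes
    with the spectral projections ([op_proj]), and on the part of the space where
    the modulus of the spectral variable lies in [[n, n+1)] it multiplies norms
    by a factor in [[n, n+1]]. It remains to start two inductions
    ([power_dom]). The exponent [0] is trivial. For the exponent [1/2], the form
    [<x, i T x>] differs from the form of [|A|] by tri-diagonal terms that are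
    absorbed up to multiples of the squared norm ([energy_bound]); in particular
    it is bounded below, which makes it comparable with the form of [|T|] as well
    ([sum_shells_le_moment]), and the form domains coincide ([half_power]).

    Bound on the coupling constant. In coordinates the real part of
    [<|A|^k x, B x>] only involves the products of consecutive coordinates of
    [x], because the diagonal of [B] is imaginary; as [B] is skew, the two
    occurrences of each product combine into
    [(lam n ^+ k - lam n.+1 ^+ k) Re (conj x_n b_(n,n+1) x_(n+1))]
    ([abel_cross]). The inequality between arithmetic and geometric means and
    the monotonicity of [lam] then give the announced supremum with constant
    exactly one ([coupling_bound]). *)

(** * Partial sums of real sequences *)

(** Convergence of a series of nonnegative terms, phrased so that estimates and
    passages to the limit only ever involve finite sums. *)
Definition bounded_sums (R : realType) (u : nat -> R) : Prop :=
  exists M, forall N, \sum_(n < N) u n <= M.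

Section RealSums.
Variable R : realType.
Implicit Types u v w g X Y lam : nat -> R.

Lemma nneseries_bounded_sums u : (forall n, 0 <= u n) ->
  (\sum_(0 <= n <oo) (u n)%:E < +oo)%E <-> bounded_sums u.
Proof.
move=> u0; have u0E n : (true -> true -> 0 <= (u n)%:E)%E by rewrite lee_fin.
split=> [h|[M hM]].
  exists (fine (\sum_(0 <= n <oo) (u n)%:E)%E) => N.
  rewrite -lee_fin fineK; last first.
    rewrite ge0_fin_numE//; apply: nneseries_ge0 => n _ _; exact: u0E.
  rewrite -sumEFin -(big_mkord xpredT (fun n => (u n)%:E)).
  by apply: nneseries_lim_ge => n _ _; exact: u0E.
apply: (@le_lt_trans _ _ M%:E); last exact: ltry.
apply: lime_le; first by apply: is_cvg_nneseries => n _ _; exact: u0E.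
by apply: nearW => N; rewrite big_mkord sumEFin lee_fin.
Qed.

Lemma bounded_sumsW u v : (forall n, u n <= v n) ->
  bounded_sums v -> bounded_sums u.
Proof.
move=> uv [M hM]; exists M => N; apply: le_trans (hM N).
by apply: ler_sum => n _; exact: uv.
Qed.

Lemma bounded_sums_scale (c : R) u : 0 <= c ->
  bounded_sums u -> bounded_sums (fun n => c * u n).
Proof.
move=> c0 [M hM]; exists (c * M) => N.
by rewrite -mulr_sumr ler_wpM2l.
Qed.

Lemma bounded_sumsD u v :
  bounded_sums u -> bounded_sums v -> bounded_sums (fun n => u n + v n).
Proof.
move=> [M hM] [M' hM']; exists (M + M') => N.
by rewrite big_split lerD.
Qed.

Lemma sum_le_more u N N' : (forall n, 0 <= u n) -> (N <= N')%N ->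
  \sum_(n < N) u n <= \sum_(n < N') u n.
Proof.
move=> u0 /subnK <-; elim: (N' - N)%N => [|m IH]; first by rewrite add0n.
by rewrite addSn big_ord_recr /= (le_trans IH)// lerDl.
Qed.

(** Neighbouring weights are comparable, so shifting the index by one in a
    weighted sum costs a factor [K] at most; this is what makes a tri-diagonal
    matrix behave like a multiplication operator. For [n = 0] the term
    [X n.-1] duplicates [X 0], which only enlarges the left-hand side. The sum
    on the right has one term more because of [X n.+1]. *)
Lemma sum_sq_neighbours (K : R) w X N : (forall n, 0 <= w n) ->
  (forall n, w n <= w n.+1) -> (forall n, w n.+1 <= K * w n) -> 0 <= K ->
  \sum_(n < N) w n * (X n.-1 + X n + X n.+1) ^+ 2 <=
  3 * (3 + K) * \sum_(n < N.+1) w n * X n ^+ 2.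
Proof.
move=> w0 wS wK K0.
set S := \sum_(n < N.+1) _.
have S0 m : 0 <= w m * X m ^+ 2 by rewrite mulr_ge0// sqr_ge0.
have S1 : \sum_(n < N) w n * X n ^+ 2 <= S.
  exact: (sum_le_more (u := fun n => w n * X n ^+ 2)).
have S2 : \sum_(n < N) w n * X n.+1 ^+ 2 <= S.
  rewrite /S big_ord_recl; apply: ler_wpDl => //=.
  by apply: ler_sum => n _; rewrite ler_wpM2r ?sqr_ge0.
have S3 : \sum_(n < N) w n * X n.-1 ^+ 2 <= (1 + K) * S.
  case: N @S S1 {S2} => [|N] S S1.
    by rewrite big_ord0 mulr_ge0 ?addr_ge0 ?sumr_ge0.
  rewrite big_ord_recl /= mulrDl mul1r lerD//.
    by rewrite /S big_ord_recl lerDl sumr_ge0.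
  apply: (@le_trans _ _ (K * \sum_(i < N) w i * X i ^+ 2)).
    rewrite mulr_sumr; apply: ler_sum => i _.
    by rewrite mulrA ler_wpM2r ?sqr_ge0 //=.
  rewrite ler_wpM2l//.
  by apply: (sum_le_more (u := fun n => w n * X n ^+ 2)) => //; lia.
apply: (@le_trans _ _ (3 * (\sum_(n < N) w n * X n.-1 ^+ 2 +
  \sum_(n < N) w n * X n ^+ 2 + \sum_(n < N) w n * X n.+1 ^+ 2))); last nra.
rewrite -!big_split mulr_sumr; apply: ler_sum => n _ /=.
rewrite -2!mulrDr [leRHS]mulrCA; apply: ler_wpM2l => //.
set a := X _; set b := X _; set c := X _.
have := sqr_ge0 (a - b); have := sqr_ge0 (b - c); have := sqr_ge0 (a - c); nra.
Qed.

(** The supremum of [S] satisfies [sup S <= D + sup S / 2]. Its finiteness is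
    essential, and it is the reason for truncating the weights in
    [tridiagonal_regularity]. *)
Lemma absorb_half (S : nat -> R) (D : R) : (exists M, forall N, S N <= M) ->
  (forall N, S N <= D + S N.+1 / 2) -> forall N, S N <= 2 * D.
Proof.
move=> [M hM] h N.
have hs : has_sup (range S).
  by split; [exists (S 0%N); exists 0%N | exists M => _ [n _ <-]].
have le_sup n : S n <= sup (range S) by apply: sup_upper_bound => //; exists n.
suff : sup (range S) <= 2 * D by exact: le_trans.
suff : sup (range S) <= D + sup (range S) / 2 by lra.
apply: ge_sup => [|_ [n _ <-]]; first by exists (S 0%N); exists 0%N.
by have := h n; have := le_sup n.+1; lra.
Qed.

Lemma bounded_sums_cvg0 u : (forall n, 0 <= u n) ->
  bounded_sums u -> u @ \oo --> (0 : R).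
Proof.
move=> u0 [M hM]; apply: (@cvg_series_cvg_0 R R^o).
apply: nondecreasing_is_cvgn.
  by apply: nondecreasing_series => n _ _; exact: u0.
by exists M => _ [n _ <-]; rewrite /series /= big_mkord; exact: hM.
Qed.

End RealSums.

(** * Tri-diagonal regularity *)

Section Weights.
Variables (R : realType) (lam : nat -> R) (L : R).
Hypothesis lam_gt0 : forall n, 0 < lam n.
Hypothesis lam_nd : forall n, lam n <= lam n.+1.
Hypothesis lam_ratio : forall n, lam n.+1 <= L * lam n.
Hypothesis L_ge0 : 0 <= L.

(** Elliptic regularity in coordinates: [X] and [Y] are the moduli of the
    coordinates of [x] and of [(A + u B) x], and the hypothesis says that [B] is
    infinitesimally small with respect to [A]. Squaring it with weight
    [lam ^+ 2 * v] bounds the weighted sum of [X] by that of [Y] plus a small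
    multiple of itself ([sum_sq_neighbours]), which can be absorbed as soon as
    it is finite. The weights are therefore frozen beyond an index [N]: the
    sums become finite, the ratio of neighbouring weights stays bounded
    independently of [N], and the resulting bound does not depend on [N]. *)
Lemma tridiagonal_regularity (v X Y : nat -> R) (K : R) :
  (forall n, 0 <= v n) -> (forall n, v n <= v n.+1) ->
  (forall n, v n.+1 <= K * v n) -> 0 <= K ->
  (forall n, 0 <= X n) -> (forall n, 0 <= Y n) ->
  (forall e, 0 < e -> exists N0, forall n, (N0 <= n)%N ->
     lam n * X n <= Y n + e * lam n * (X n.-1 + X n + X n.+1)) ->
  bounded_sums (fun n => X n ^+ 2) ->
  bounded_sums (fun n => v n * Y n ^+ 2) ->
  bounded_sums (fun n => lam n ^+ 2 * v n * X n ^+ 2).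
Proof.
move=> v0 vS vK K0 X0 Y0 small [MX hMX] [MY hMY].
pose g n := lam n ^+ 2 * v n.
have lam0 n : 0 <= lam n by exact: ltW.
have g0 n : 0 <= g n by rewrite mulr_ge0 ?sqr_ge0.
have gS n : g n <= g n.+1 by rewrite ler_pM ?sqr_ge0 ?lerXn2r ?nnegrE.
pose Kg := L ^+ 2 * K.
have Kg0 : 0 <= Kg by rewrite mulr_ge0 ?sqr_ge0.
have gK n : g n.+1 <= Kg * g n.
  have -> : Kg * g n = (L * lam n) ^+ 2 * (K * v n) by rewrite /Kg /g; ring.
  by rewrite ler_pM ?sqr_ge0 ?lerXn2r ?nnegrE ?mulr_ge0.
have g_nd : {homo g : m n / (m <= n)%N >-> m <= n}.
  by apply: homo_leq => //; exact: le_trans.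
(* Chosen so that [6 * e ^+ 2 * (4 + Kg) <= 1 / 2], where [1 + Kg] bounds the
   ratio of neighbouring frozen weights. *)
pose e : R := (4 * (3 + Kg))^-1.
have e_gt0 : 0 < e by rewrite invr_gt0; lra.
have [N0 hN0] := small e e_gt0.
pose D := \sum_(n < N0) g n * X n ^+ 2 + 2 * MY.
exists (2 * D) => N.
(* The weights frozen beyond [N]; they agree with [g] on the sum at hand. *)
pose w n := g (minn n N).
have w0 n : 0 <= w n by exact: g0.
have wS n : w n <= w n.+1 by apply: g_nd; lia.
have wg n : w n <= g n by apply: g_nd; lia.
have wK n : w n.+1 <= (1 + Kg) * w n.
  rewrite /w; have [ltnN|leNn] := ltnP n N.
    have -> : minn n.+1 N = n.+1 by lia.
    by rewrite mulrDl mul1r ler_wpDl.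
  have -> : minn n.+1 N = N by lia.
  by rewrite mulrDl mul1r lerDl mulr_ge0.
have -> : \sum_(n < N) lam n ^+ 2 * v n * X n ^+ 2 = \sum_(n < N) w n * X n ^+ 2.
  by apply: eq_bigr => n _; rewrite /w (minn_idPl _) // ltnW.
apply: (absorb_half (S := fun N' => \sum_(n < N') w n * X n ^+ 2)) => [|N'].
  exists (g N * MX) => N'; apply: (@le_trans _ _ (\sum_(n < N') g N * X n ^+ 2)).
    by apply: ler_sum => n _; rewrite ler_wpM2r ?sqr_ge0// g_nd// geq_minr.
  by rewrite -mulr_sumr ler_wpM2l.
have termwise n : w n * X n ^+ 2 <= (if (n < N0)%N then g n * X n ^+ 2 else 0) +
    (2 * (v n * Y n ^+ 2) + 2 * e ^+ 2 * (w n * (X n.-1 + X n + X n.+1) ^+ 2)).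
  have rest : 0 <= 2 * (v n * Y n ^+ 2) +
      2 * e ^+ 2 * (w n * (X n.-1 + X n + X n.+1) ^+ 2).
    by apply: addr_ge0; apply: mulr_ge0 => //;
      apply: mulr_ge0 => //; exact: sqr_ge0.
  case: ltnP => [ltnN0|leN0n].
    by apply: ler_wpDr => //; rewrite ler_wpM2r ?sqr_ge0.
  rewrite add0r.
  set Z := X n.-1 + X n + X n.+1.
  have wl : w n / lam n ^+ 2 <= v n.
    by rewrite ler_pdivrMr ?exprn_gt0// mulrC; exact: wg.
  have wl0 : 0 <= w n / lam n ^+ 2 by rewrite divr_ge0 ?sqr_ge0.
  have hn : (lam n * X n) ^+ 2 <= 2 * Y n ^+ 2 + 2 * e ^+ 2 * (lam n * Z) ^+ 2.
    apply: (@le_trans _ _ ((Y n + e * lam n * Z) ^+ 2)).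
      rewrite lerXn2r ?nnegrE ?hN0 ?mulr_ge0//.
      by rewrite addr_ge0// !mulr_ge0 ?addr_ge0// ltW.
    rewrite -mulrA; set p := Y n; set q := lam n * Z.
    by have := sqr_ge0 (p - e * q); nra.
  have -> : w n * X n ^+ 2 = w n / lam n ^+ 2 * (lam n * X n) ^+ 2.
    by have := gt_eqF (lam_gt0 n) => ?; field; apply/negbT.
  apply: (le_trans (ler_wpM2l wl0 hn)).
  rewrite mulrDr lerD//.
    by rewrite mulrCA ler_wpM2l// ler_wpM2r ?sqr_ge0.
  rewrite le_eqVlt; apply/orP; left; apply/eqP.
  by have := gt_eqF (lam_gt0 n) => ?; field; apply/negbT.
apply: le_trans; first by apply: ler_sum => i _; exact: (termwise i).
rewrite !big_split /= -!mulr_sumr /D -!addrA; apply: lerD.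
  case: (leqP N' N0) => h.
    apply: le_trans (sum_le_more (u := fun n => g n * X n ^+ 2) _ h).
      by apply: ler_sum => n _; case: ifP; rewrite ?mulr_ge0 ?sqr_ge0.
    by move=> n; rewrite mulr_ge0 ?sqr_ge0.
  rewrite -(big_mkord xpredT (fun n => if (n < N0)%N then g n * X n ^+ 2 else 0)).
  rewrite (big_cat_nat _ (n := N0))//=; last exact: ltnW.
  rewrite [X in _ + X]big_nat_cond [X in _ + X]big1 ?addr0; last first.
    by move=> i /andP[/andP[h1 _] _]; rewrite ltnNge h1.
  rewrite big_mkord; apply: ler_sum => i _; by rewrite ltn_ord lexx.
apply: lerD; first by rewrite ler_wpM2l// hMY.
have := @sum_sq_neighbours R (1 + Kg) w X N' w0 wS wK (addr_ge0 ler01 Kg0).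
set S := \sum_(n < N'.+1) _ => hS.
have S0 : 0 <= S by rewrite sumr_ge0// => i _; rewrite mulr_ge0 ?sqr_ge0.
apply: (le_trans (ler_wpM2l _ hS)); first by rewrite mulr_ge0 ?sqr_ge0.
rewrite mulrA [S / 2]mulrC ler_wpM2r//.
have -> : 2 * e ^+ 2 * (3 * (3 + (1 + Kg))) = 6 * e * (e * (4 + Kg)) by ring.
have e12 : e * 12 <= 1.
  by rewrite mulrC ler_pdivrMr ?mul1r; lra.
have e4 : e * (4 + Kg) <= 1 by rewrite mulrC ler_pdivrMr ?mul1r; lra.
have : 0 <= e * (4 + Kg) by rewrite mulr_ge0; lra.
nra.
Qed.

End Weights.

(** * Inner products and norm convergence *)

Lemma sum_ord_split (V : zmodType) (F : nat -> V) N n : (N <= n)%N ->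
  \sum_(j < n) F j = \sum_(j < N) F j + \sum_(N <= j < n) F j.
Proof.
by move=> Nn; rewrite -!(big_mkord xpredT F) (big_cat_nat _ (n := N)).
Qed.

Lemma cvg_sum_ord (R : realType) (F : nat -> nat -> R) (a : nat -> R) N :
  (forall n, F n @ \oo --> a n) ->
  (fun m => \sum_(n < N) F n m) @ \oo --> \sum_(n < N) a n.
Proof. by move=> h; apply: cvg_big => //; exact: add_continuous. Qed.

Section Inner.
Variables (R : realType) (H : completeNormedModType R[i]).
Variable dot : {dot H for Num.conj}.
Hypothesis hilb : is_hilbert dot.
Local Notation ip := (inner dot).
Local Notation Re := complex.Re.
Local Notation Im := complex.Im.
Local Notation normc := Normc.normc.
Implicit Types x y z : H.

(** The norm of [H] takes its values in [R[i]]; the estimates below need a real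
    number. *)
Definition hnorm x : R := Re `|x|.

Lemma hnormE x : `|x| = (hnorm x)%:C.
Proof. by rewrite /hnorm RRe_real// realE normr_ge0. Qed.

Lemma normrE_normc (z : R[i]) : `|z| = (normc z)%:C. Proof. by []. Qed.

Lemma normc_ge0 (z : R[i]) : 0 <= normc z.
Proof. by rewrite -ler0c -normrE_normc. Qed.

Lemma normc_sq (z : R[i]) : normc z ^+ 2 = Re z ^+ 2 + Im z ^+ 2.
Proof. by case: z => a b /=; rewrite sqr_sqrtr// addr_ge0 ?sqr_ge0. Qed.

Lemma Re_le_normc (z : R[i]) : `|Re z| <= normc z.
Proof.
rewrite -ler_sqr ?nnegrE ?normc_ge0// normc_sq real_normK ?num_real//.
by rewrite lerDl sqr_ge0.
Qed.

Lemma Im_le_normc (z : R[i]) : `|Im z| <= normc z.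
Proof.
rewrite -ler_sqr ?nnegrE ?normc_ge0// normc_sq real_normK ?num_real//.
by rewrite lerDr sqr_ge0.
Qed.

Lemma normc_real (a : R) : normc a%:C = `|a|.
Proof. by rewrite /= expr0n addr0 sqrtr_sqr. Qed.

Lemma normc_conj (z : R[i]) : normc (conjc z) = normc z.
Proof. by case: z => a b /=; rewrite sqrrN. Qed.

Lemma normcB_sym (z w : R[i]) : normc (z - w) = normc (w - z).
Proof. by rewrite -opprB normcN. Qed.

Lemma mulcJ (z : R[i]) : z * conjc z = (normc z ^+ 2)%:C.
Proof. by rewrite -sqr_normc normrE_normc rmorphXn. Qed.

Lemma ReD (a b : R[i]) : Re (a + b) = Re a + Re b.
Proof. by case: a b => ? ? [? ?]. Qed.
Lemma ImD (a b : R[i]) : Im (a + b) = Im a + Im b.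
Proof. by case: a b => ? ? [? ?]. Qed.
Lemma ReN (a : R[i]) : Re (- a) = - Re a.
Proof. by case: a. Qed.
Lemma ImN (a : R[i]) : Im (- a) = - Im a.
Proof. by case: a. Qed.
Lemma ReJ (a : R[i]) : Re (conjc a) = Re a.
Proof. by case: a. Qed.
Lemma ImJ (a : R[i]) : Im (conjc a) = - Im a.
Proof. by case: a. Qed.

Lemma hnorm_ge0 x : 0 <= hnorm x.
Proof. by rewrite -ler0c -hnormE. Qed.

Lemma hnorm0 : hnorm 0 = 0.
Proof. by rewrite /hnorm normr0. Qed.

Lemma hnorm_eq0 x : hnorm x = 0 -> x = 0.
Proof. by move=> h; apply/normr0_eq0; rewrite hnormE h. Qed.

Lemma hnorm_opp x : hnorm (- x) = hnorm x.
Proof. by rewrite /hnorm normrN. Qed.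

Lemma hnorm_distC x y : hnorm (x - y) = hnorm (y - x).
Proof. by rewrite -opprB hnorm_opp. Qed.

Lemma hnorm_triangle x y : hnorm (x + y) <= hnorm x + hnorm y.
Proof. by rewrite -lecR rmorphD /= -!hnormE ler_normD. Qed.

Lemma hnormZ (a : R[i]) x : hnorm (a *: x) = normc a * hnorm x.
Proof.
apply: (@complexI R); rewrite -hnormE normrZ hnormE normrE_normc.
by rewrite -[RHS]/(real_complex R _) rmorphM.
Qed.

Lemma ipDr x y z : ip x (y + z) = ip x y + ip x z.
Proof. by rewrite /inner linearDl. Qed.
Lemma ipDl x y z : ip (y + z) x = ip y x + ip z x.
Proof. by rewrite /inner linearDr. Qed.
Lemma ipZr (a : R[i]) x y : ip x (a *: y) = a * ip x y.
Proof. by rewrite /inner linearZl_LR. Qed.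
Lemma ipZl (a : R[i]) x y : ip (a *: x) y = conjc a * ip x y.
Proof. by rewrite /inner linearZr_LR. Qed.
Lemma ipNr x y : ip x (- y) = - ip x y.
Proof. by rewrite /inner linearNl. Qed.
Lemma ipNl x y : ip (- x) y = - ip x y.
Proof. by rewrite /inner linearNr. Qed.
Lemma ip0r x : ip x 0 = 0.
Proof. by rewrite /inner linear0l. Qed.
Lemma ip0l x : ip 0 x = 0.
Proof. by rewrite /inner linear0r. Qed.
Lemma ipBr x y z : ip x (y - z) = ip x y - ip x z.
Proof. by rewrite ipDr ipNr. Qed.
Lemma ipBl x y z : ip (y - z) x = ip y x - ip z x.
Proof. by rewrite ipDl ipNl. Qed.
Lemma ipC x y : ip x y = conjc (ip y x).
Proof. by rewrite /inner hermC mul1r. Qed.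
Lemma ip_sumr x (I : Type) (r : seq I) (F : I -> H) :
  ip x (\sum_(i <- r) F i) = \sum_(i <- r) ip x (F i).
Proof.
elim: r => [|i r IH]; first by rewrite !big_nil ip0r.
by rewrite !big_cons ipDr IH.
Qed.
Lemma ip_suml x (I : Type) (r : seq I) (F : I -> H) :
  ip (\sum_(i <- r) F i) x = \sum_(i <- r) ip (F i) x.
Proof.
elim: r => [|i r IH]; first by rewrite !big_nil ip0l.
by rewrite !big_cons ipDl IH.
Qed.

Lemma ipxx x : ip x x = (hnorm x ^+ 2)%:C.
Proof. by rewrite hilb hnormE rmorphXn. Qed.

Lemma hnorm_sq x : hnorm x ^+ 2 = Re (ip x x).
Proof. by rewrite ipxx. Qed.

Lemma hnorm_sqD x y : ip x y = 0 ->
  hnorm (x + y) ^+ 2 = hnorm x ^+ 2 + hnorm y ^+ 2.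
Proof.
move=> xy; have yx : ip y x = 0 by rewrite ipC xy conjc0.
by rewrite !hnorm_sq ipDr !ipDl xy yx add0r addr0 raddfD.
Qed.

(** The squared norm of [`|y| ^+ 2 *: x - <y, x> *: y] is [`|y| ^+ 2] times
    [`|x| ^+ 2 * `|y| ^+ 2 - |<x, y>| ^+ 2]. *)
Lemma cauchy_schwarz x y : normc (ip x y) <= hnorm x * hnorm y.
Proof.
have [y0|y0] := eqVneq (hnorm y) 0.
  by rewrite (hnorm_eq0 y0) ip0r hnorm0 mulr0 normc_real normr0.
have yp : 0 < hnorm y ^+ 2 by rewrite exprn_even_gt0.
rewrite -ler_sqr ?nnegrE ?normc_ge0 ?mulr_ge0 ?hnorm_ge0//.
rewrite exprMn -subr_ge0 -(pmulr_rge0 _ yp).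
pose z := (hnorm y ^+ 2)%:C *: x - ip y x *: y.
suff -> : hnorm y ^+ 2 * (hnorm x ^+ 2 * hnorm y ^+ 2 - normc (ip x y) ^+ 2) =
  hnorm z ^+ 2 by exact: sqr_ge0.
apply: (@complexI R); rewrite -[RHS]ipxx /z ipBr !ipBl !ipZr !ipZl.
rewrite !(ipxx x, ipxx y) conjc_real [ip y x]ipC conjcK.
have CM (a b : R) : (a * b)%:C = a%:C * b%:C by exact: rmorphM.
have CB (a b : R) : (a - b)%:C = a%:C - b%:C by exact: rmorphB.
have := mulcJ (ip x y).
move: (normc _ ^+ 2) (hnorm x ^+ 2) (hnorm y ^+ 2) => r p q rE.
rewrite !(CM, CB) -rE.
set a := _%:C; set b := _%:C; set c := ip x y; set d := conjc c.
by ring.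
Qed.

Lemma Re_ip_le x y : `|Re (ip x y)| <= hnorm x * hnorm y.
Proof. exact: le_trans (Re_le_normc _) (cauchy_schwarz _ _). Qed.
Lemma Im_ip_le x y : `|Im (ip x y)| <= hnorm x * hnorm y.
Proof. exact: le_trans (Im_le_normc _) (cauchy_schwarz _ _). Qed.

(** Convergence in [H], tested on real norms. *)
Definition hcvg (f : nat -> H) x : Prop :=
  (fun n => hnorm (f n - x)) @ \oo --> (0 : R).

Lemma hcvg_near f x : hcvg f x <->
  forall e : R, 0 < e -> exists N, forall n, (N <= n)%N -> hnorm (f n - x) < e.
Proof.
split=> [/cvgrPdist_lt h e e0|h].
  have [N _ hN] := h e e0; exists N => n Nn; have := hN n Nn.
  by rewrite /= sub0r normrN ger0_norm ?hnorm_ge0.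
apply/cvgrPdist_lt => e e0; have [N hN] := h e e0.
by exists N => // n /hN; rewrite /= sub0r normrN ger0_norm ?hnorm_ge0.
Qed.

Lemma cvg_hcvg f x : (f : nat -> H) @ \oo --> x -> hcvg f x.
Proof.
move=> /cvgrPdist_lt h; apply/hcvg_near => e e0.
have [|N _ hN] := h e%:C; first by rewrite ltcR.
by exists N => n /hN /=; rewrite hnormE ltcR hnorm_distC.
Qed.

Lemma hcvg_cvg f x : hcvg f x -> (f : nat -> H) @ \oo --> x.
Proof.
move=> /hcvg_near h; apply/cvgrPdist_lt => e e0.
have [eE e0'] : e = (Re e)%:C /\ 0 < Re e.
  by case: e e0 => a b; rewrite ltcE /= => /andP[/eqP -> ->].
have [N hN] := h (Re e) e0'.
by exists N => // n /hN; rewrite /= eE hnormE ltcR hnorm_distC.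
Qed.

Lemma cvg_dominated (u a : nat -> R) (l : R) :
  (forall n, `|u n - l| <= a n) -> a @ \oo --> (0 : R) -> u @ \oo --> l.
Proof.
move=> ua a0; apply/cvgrPdist_le => e e0.
move/cvgrPdist_le: a0 => /(_ e e0) [N _ hN]; exists N => // n /hN /=.
rewrite sub0r normrN => h; rewrite distrC; apply: le_trans (ua n) _.
exact: le_trans (ler_norm _) h.
Qed.

Lemma hcvg_norm f x : hcvg f x -> (fun n => hnorm (f n)) @ \oo --> hnorm x.
Proof.
apply: cvg_dominated => n; rewrite ler_norml; apply/andP; split.
  by have := hnorm_triangle (x - f n) (f n); rewrite subrK (hnorm_distC x); lra.
by have := hnorm_triangle (f n - x) x; rewrite subrK; lra.
Qed.

Lemma hcvg_lip (h : H -> R) (C : R) f x :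
  (forall y z, `|h y - h z| <= C * hnorm (y - z)) -> hcvg f x ->
  (fun n => h (f n)) @ \oo --> h x.
Proof.
move=> hC fx; apply: cvg_dominated (fun n => hC (f n) x) _.
by rewrite -[X in _ --> X](mulr0 C); apply: cvgMr.
Qed.

Lemma hcvg_Re_ip y f x : hcvg f x ->
  (fun n => Re (ip y (f n))) @ \oo --> Re (ip y x).
Proof.
apply: (@hcvg_lip (fun z => Re (ip y z)) (hnorm y)) => z w.
by rewrite -raddfB -ipBr Re_ip_le.
Qed.
Lemma hcvg_Im_ip y f x : hcvg f x ->
  (fun n => Im (ip y (f n))) @ \oo --> Im (ip y x).
Proof.
apply: (@hcvg_lip (fun z => Im (ip y z)) (hnorm y)) => z w.
by rewrite -raddfB -ipBr Im_ip_le.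
Qed.
Lemma hcvg_normc_ip y f x : hcvg f x ->
  (fun n => normc (ip y (f n))) @ \oo --> normc (ip y x).
Proof.
apply: (@hcvg_lip (fun z => normc (ip y z)) (hnorm y)) => z w.
apply: le_trans (cauchy_schwarz y (z - w)); rewrite ipBr ler_norml.
apply/andP; split.
  by have := le_normcD (ip y w - ip y z) (ip y z); rewrite subrK normcB_sym; lra.
by have := le_normcD (ip y z - ip y w) (ip y w); rewrite subrK; lra.
Qed.

Lemma dense_hnorm (D : set H) x (e : R) : dense D -> 0 < e ->
  exists2 y, D y & hnorm (x - y) < e.
Proof.
move=> Dd e0; have e0' : 0 < e%:C by rewrite ltcR.
have hop : open (ball x e%:C) by exact: ball_open.
have [|y [By Dy]] := Dd (ball x e%:C) _ hop.
  by exists x; exact: ballxx.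
by exists y => //; move: By; rewrite -ball_normE /= hnormE ltcR.
Qed.

Lemma dense_orth (D : set H) v : dense D ->
  (forall x, D x -> ip x v = 0) -> v = 0.
Proof.
move=> Dd h; apply/eqP/negPn/negP => v0.
have vp : 0 < hnorm v.
  rewrite lt_neqAle hnorm_ge0 andbT; apply: contra v0 => /eqP e.
  by rewrite (@hnorm_eq0 v).
have [y Dy yv] := dense_hnorm v Dd vp.
have := Re_ip_le (v - y) v; rewrite ipBl (h y Dy) subr0 -hnorm_sq.
rewrite ger0_norm ?sqr_ge0// expr2 => hh.
by move: (hh); rewrite ler_pM2r// leNgt yv.
Qed.

End Inner.

(** * Hilbert bases *)

Section Basis.
Variables (R : realType) (H : completeNormedModType R[i]).
Variable dot : {dot H for Num.conj}.
Hypothesis hilb : is_hilbert dot.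
Variable phi : nat -> H.
Hypothesis basis : hilbert_basis dot phi.
Local Notation ip := (inner dot).
Local Notation Re := complex.Re.
Local Notation Im := complex.Im.
Local Notation normc := Normc.normc.
Local Notation hnorm := (@hnorm R H).
Local Notation hcvg := (@hcvg R H).
Implicit Types x y z : H.

Definition psum (c : nat -> R[i]) N : H := \sum_(j < N) c j *: phi j.
Definition coef x n : R[i] := ip (phi n) x.

Lemma ip_phi j k : ip (phi j) (phi k) = (j == k)%:R.
Proof. exact: basis.1. Qed.

Lemma coef_psum c N n : coef (psum c N) n = if (n < N)%N then c n else 0.
Proof.
rewrite /coef /psum ip_sumr; under eq_bigr do rewrite ipZr ip_phi.
case: ltnP => nN; last first.
  by rewrite big1// => i _; rewrite (gtn_eqF (leq_trans (ltn_ord i) nN)) mulr0.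
rewrite (bigD1 (Ordinal nN))//= eqxx mulr1 big1 ?addr0// => i /negPf.
by rewrite -val_eqE /= eq_sym => ->; rewrite mulr0.
Qed.

Lemma ip_psuml c N x : ip (psum c N) x = \sum_(j < N) conjc (c j) * coef x j.
Proof. by rewrite ip_suml; under eq_bigr do rewrite ipZl. Qed.

Lemma hnorm_psum c N : hnorm (psum c N) ^+ 2 = \sum_(j < N) normc (c j) ^+ 2.
Proof.
apply: (@complexI R); rewrite -(ipxx hilb) ip_psuml [RHS]rmorph_sum.
by apply: eq_bigr => j _; rewrite coef_psum ltn_ord mulrC mulcJ.
Qed.

Lemma psumB c d N : psum c N - psum d N = psum (fun n => c n - d n) N.
Proof.
by rewrite /psum -sumrB; apply: eq_bigr => j _; rewrite scalerBl.
Qed.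

(** Pythagoras: the remainder of the Fourier sum is orthogonal to the first
    [N] basis vectors. In particular Fourier sums are best approximations. *)
Lemma psum_best c N x : hnorm (x - psum c N) ^+ 2 =
  hnorm (x - psum (coef x) N) ^+ 2 + \sum_(j < N) normc (coef x j - c j) ^+ 2.
Proof.
rewrite -(hnorm_psum (fun j => coef x j - c j)) -psumB -(hnorm_sqD hilb).
  by rewrite addrA subrK.
rewrite ipC psumB ip_psuml big1 ?conjc0// => j _.
by rewrite /coef ipBr -/(coef x j) -/(coef _ j) coef_psum ltn_ord subrr mulr0.
Qed.

Lemma hnorm_sub_psum N x : hnorm (x - psum (coef x) N) ^+ 2 =
  hnorm x ^+ 2 - \sum_(j < N) normc (coef x j) ^+ 2.
Proof.
have := psum_best (fun _ => 0) N x.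
have -> : psum (fun _ => 0) N = 0 by rewrite /psum big1// => j _; rewrite scale0r.
rewrite subr0 => ->; under [X in _ + X - _]eq_bigr do rewrite subr0.
by rewrite addrK.
Qed.

Lemma bessel N x : \sum_(j < N) normc (coef x j) ^+ 2 <= hnorm x ^+ 2.
Proof. by rewrite -subr_ge0 -hnorm_sub_psum sqr_ge0. Qed.

(** Density gives one good approximation by a finite combination; Fourier sums
    are at least as good, and they only improve when [N] grows. *)
Lemma psum_coef_cvg x : hcvg (psum (coef x)) x.
Proof.
apply/hcvg_near => e e0.
have [y [N [c ->]] xy] := dense_hnorm x basis.2 e0.
exists N => n Nn; rewrite hnorm_distC; apply: le_lt_trans xy.
pose d j := if insub j is Some i then c i else 0.
have -> : \sum_(j < N) c j *: phi j = psum d N.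
  by apply: eq_bigr => j _; rewrite /d valK.
rewrite -ler_sqr ?nnegrE ?hnorm_ge0//.
apply: (@le_trans _ _ (hnorm (x - psum (coef x) N) ^+ 2)); last first.
  by rewrite (psum_best d) lerDl sumr_ge0// => j _; exact: sqr_ge0.
rewrite !hnorm_sub_psum lerD2l lerN2.
apply: (sum_le_more (u := fun j => normc (coef x j) ^+ 2)) => // j.
exact: sqr_ge0.
Qed.

Lemma coef_inj x y : coef x =1 coef y -> x = y.
Proof.
move=> h; apply/eqP; rewrite -subr_eq0; apply/eqP/hnorm_eq0.
have := psum_coef_cvg (x - y).
have -> : psum (coef (x - y)) = fun=> 0.
  apply/funext => N; rewrite /psum big1// => j _.
  by rewrite /coef ipBr -!/(coef _ _) h subrr scale0r.
have h1 : (fun n : nat => hnorm (0 - (x - y))) @ \oo --> hnorm (x - y).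
  by rewrite sub0r hnorm_opp; exact: cvg_cst.
by move=> h0; exact: (cvg_unique (@Rhausdorff R) h1 h0).
Qed.

(** The partial sums are Cauchy because their mutual distances are tails of the
    series of squared moduli; completeness of [H] does the rest. *)
Lemma riesz_fischer c : bounded_sums (fun n => normc (c n) ^+ 2) ->
  exists2 x, hcvg (psum c) x & coef x =1 c.
Proof.
pose u n := normc (c n) ^+ 2; move=> [M hM].
have u0 n : 0 <= u n by exact: sqr_ge0.
have cvu : cvgn (series u).
  apply: nondecreasing_is_cvgn.
    by apply: nondecreasing_series => n _ _; exact: u0.
  by exists M => _ [n _ <-]; rewrite /series /= big_mkord; exact: hM.
have cauchyu : cauchy (series u @ \oo) by exact: cvg_cauchy.
have : cvgn (psum c).
  apply: cauchy_cvg; apply/cauchy_exP => e e0.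
  have [eE e0'] : e = (Re e)%:C /\ 0 < Re e.
    by case: e e0 => a b; rewrite ltcE /= => /andP[/eqP -> ->].
  have [N hN] : exists N, forall n, (N <= n)%N ->
      series u n - series u N < Re e ^+ 2.
    have e2 : 0 < Re e ^+ 2 / 2 by rewrite divr_gt0// exprn_gt0.
    move/cvgrPdist_lt : cvu => /(_ _ e2) [N _ hN]; exists N => n Nn.
    have := hN n Nn; have := hN N (leqnn _) => /=; set l := limn _.
    by rewrite !ltr_norml => /andP[h1 h2] /andP[h3 h4]; lra.
  exists (psum c N); exists N => // n /= Nn.
  rewrite -ball_normE /= eE hnormE ltcR hnorm_distC.
  rewrite -ltr_sqr ?nnegrE ?hnorm_ge0 ?(ltW e0')//.
  apply: le_lt_trans (hN n Nn).
  have -> : psum c N = psum (fun j => if (j < N)%N then c j else 0) n.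
    rewrite /psum.
    rewrite (sum_ord_split (fun j => (if (j < N)%N then c j else 0) *: phi j) Nn).
    rewrite [X in _ + X]big_nat_cond [X in _ + X]big1 ?addr0.
      by apply: eq_bigr => i _; rewrite ltn_ord.
    by move=> i /andP[/andP[h1 _] _]; rewrite ltnNge h1 scale0r.
  rewrite psumB hnorm_psum /series /= !big_mkord.
  pose w j := normc (c j - (if (j < N)%N then c j else 0)) ^+ 2.
  rewrite (sum_ord_split w Nn) (sum_ord_split u Nn).
  rewrite big1 ?add0r; last first.
    by move=> i _; rewrite /w ltn_ord subrr Normc.normc0 expr0n.
  rewrite [leRHS]addrAC subrr add0r; apply: ler_sum_nat => i /andP[h1 _].
  by rewrite /w /u ltnNge h1 /= subr0.
move=> cvp; exists (limn (psum c)); first exact: cvg_hcvg.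
move=> n; have h := cvg_hcvg cvp.
have rr : (fun m => Re (coef (psum c m) n)) @ \oo --> Re (c n).
  by apply: cvg_near_cst; exists n.+1 => // m /= nm; rewrite coef_psum nm.
have ii : (fun m => Im (coef (psum c m) n)) @ \oo --> Im (c n).
  by apply: cvg_near_cst; exists n.+1 => // m /= nm; rewrite coef_psum nm.
have hr := cvg_unique (@Rhausdorff R) (hcvg_Re_ip hilb (y := phi n) h) rr.
have hi := cvg_unique (@Rhausdorff R) (hcvg_Im_ip hilb (y := phi n) h) ii.
move: hr hi; rewrite /coef.
by case: (ip _ _) => a b; case: (c n) => a' b' /= -> ->.
Qed.

Lemma parseval_Re x y :
  (fun N => \sum_(n < N) Re (conjc (coef x n) * coef y n)) @ \oo --> Re (ip x y).
Proof.
have -> : (fun N => \sum_(n < N) Re (conjc (coef x n) * coef y n)) =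
  (fun N => Re (ip y (psum (coef x) N))).
  apply/funext => N; rewrite ipC ip_psuml raddf_sum.
  rewrite [RHS](_ : _ = Re (\sum_(i < N) conjc (coef x i) * coef y i)); last first.
    by rewrite -raddf_sum; case: (\sum_(i < N) _).
  by rewrite raddf_sum.
have := hcvg_Re_ip hilb (y := y) (psum_coef_cvg x).
by rewrite [ip y x]ipC; case: (ip x y).
Qed.

End Basis.

(** * Projection-valued measures *)

Section Pvm.
Variables (R : realType) (H : completeNormedModType R[i]).
Variable dot : {dot H for Num.conj}.
Hypothesis hilb : is_hilbert dot.
Variable E : pvm dot.
Local Notation ip := (inner dot).
Local Notation Re := complex.Re.
Local Notation Im := complex.Im.
Local Notation normc := Normc.normc.
Local Notation hnorm := (@hnorm R H).
Local Notation hcvg := (@hcvg R H).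
Local Notation mu := (pvm_mu E).
Implicit Types (x y z : H) (S : set (measurableTypeR R)).

Lemma pvmD S x y : measurable S -> E S (x + y) = E S x + E S y.
Proof. by move=> mS; have := pvm_linear E mS 1 x y; rewrite !scale1r. Qed.

Lemma pvm0 S : measurable S -> E S 0 = 0.
Proof.
by move=> mS; apply: (addIr (E S 0)); rewrite -pvmD// !add0r.
Qed.

Lemma pvmN S x : measurable S -> E S (- x) = - E S x.
Proof.
by move=> mS; apply/eqP; rewrite -addr_eq0 -pvmD// addNr pvm0.
Qed.

Lemma pvmB S x y : measurable S -> E S (x - y) = E S x - E S y.
Proof. by move=> mS; rewrite pvmD// pvmN. Qed.

Lemma pvmZ S (a : R[i]) x : measurable S -> E S (a *: x) = a *: E S x.
Proof.
move=> mS; have := pvm_linear E mS a x 0.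
by rewrite !addr0 pvm0// addr0.
Qed.

Lemma pvm_idem S x : measurable S -> E S (E S x) = E S x.
Proof. by move=> mS; rewrite -pvm_setI// setIid. Qed.

Lemma pvm_ip S x : measurable S -> ip x (E S x) = (hnorm (E S x) ^+ 2)%:C.
Proof. by move=> mS; rewrite -{1}(pvm_idem _ mS) pvm_sym// (ipxx hilb). Qed.

Lemma pvm_mu_hnorm S x : measurable S -> mu x S = (hnorm (E S x) ^+ 2)%:E.
Proof. by move=> mS; rewrite pvm_muE// pvm_ip. Qed.

Lemma pvm_mu_setT x : mu x setT = (hnorm x ^+ 2)%:E.
Proof. by rewrite pvm_mu_hnorm ?pvm_setT. Qed.

Lemma hnorm_pvm_split S x : measurable S ->
  hnorm x ^+ 2 = hnorm (E S x) ^+ 2 + hnorm (x - E S x) ^+ 2.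
Proof.
move=> mS; rewrite -(hnorm_sqD hilb); first by rewrite addrC subrK.
by rewrite -pvm_sym// pvmB// pvm_idem// subrr ip0r.
Qed.

Lemma hnorm_pvm_le S x : measurable S -> hnorm (E S x) <= hnorm x.
Proof.
move=> mS; rewrite -ler_sqr ?nnegrE ?hnorm_ge0// (hnorm_pvm_split x mS).
by rewrite lerDl sqr_ge0.
Qed.

Lemma hnorm_pvmU S S' x : measurable S -> measurable S' -> [disjoint S & S'] ->
  hnorm (E (S `|` S') x) ^+ 2 = hnorm (E S x) ^+ 2 + hnorm (E S' x) ^+ 2.
Proof.
move=> mS mS' /disj_set2P d; apply: EFin_inj.
rewrite EFinD -!pvm_mu_hnorm//; last exact: measurableU.
exact: measureU.
Qed.

(** Projecting by [E S] restricts the measure of a vector to [S], and the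
    complementary projection restricts it to the complement
    ([pvm_mu_compl]). All integrals of projected vectors follow from this. *)
Lemma pvm_mu_proj S S' x : measurable S -> measurable S' ->
  mu (E S x) S' = mu x (S' `&` S).
Proof.
by move=> mS mS'; rewrite !pvm_mu_hnorm ?pvm_setI//; exact: measurableI.
Qed.

Lemma pvm_mu_compl S S' x : measurable S -> measurable S' ->
  mu (x - E S x) S' = mu x (S' `\` S).
Proof.
move=> mS mS'; have mI : measurable (S' `&` S) by exact: measurableI.
have mD : measurable (S' `\` S) by exact: measurableD.
have : mu x S' = (mu x (S' `&` S) + mu x (S' `\` S))%E.
  rewrite -measureU//; first by rewrite setUIDK.
  by rewrite setDE setICA setIA -setIA -setIA setICr !setI0.
rewrite [X in _ -> _ = X]pvm_mu_hnorm// !pvm_mu_hnorm// -EFinD => -[e].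
congr EFin; move: e; rewrite pvm_setI// pvmB// => e.
have := hnorm_pvm_split (E S' x) mS.
have -> : E S (E S' x) = E S' (E S x) by rewrite -!pvm_setI// setIC.
by rewrite e => /addrI ->.
Qed.

Lemma ge0_integral_pvm_proj S x (f : measurableTypeR R -> \bar R) :
  measurable S -> measurable_fun setT f -> (forall t, 0 <= f t)%E ->
  (\int[mu (E S x)]_t f t = \int[mu x]_(t in S) f t)%E.
Proof.
move=> mS mf f0; have mC : measurable (~` S) by exact: measurableC.
rewrite -(setUv S) ge0_integral_setU//; last 2 first.
- by rewrite setUv.
- by apply/disj_setPCl.
rewrite [X in (_ + X)%E]null_set_integral ?adde0//; last 2 first.
- exact: measurable_funS mf.
- by rewrite pvm_mu_proj// setICl measure0.
by apply: eq_measure_integral => A mA AS; rewrite pvm_mu_proj// (setIidl AS).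
Qed.

Lemma ge0_integral_pvm_compl S x (f : measurableTypeR R -> \bar R) :
  measurable S -> measurable_fun setT f -> (forall t, 0 <= f t)%E ->
  (\int[mu (x - E S x)%R]_t f t = \int[mu x]_(t in ~` S) f t)%E.
Proof.
move=> mS mf f0; have mC : measurable (~` S) by exact: measurableC.
rewrite -(setUv S) ge0_integral_setU//; last 2 first.
- by rewrite setUv.
- by apply/disj_setPCl.
rewrite [X in (X + _)%E]null_set_integral ?add0e//; last 2 first.
- exact: measurable_funS mf.
- by rewrite pvm_mu_compl// setDv measure0.
apply: eq_measure_integral => A mA AS; rewrite pvm_mu_compl// setDE.
by rewrite (setIidl AS).
Qed.

Lemma integral_pvm_proj S x (f : measurableTypeR R -> \bar R) :
  measurable S -> measurable_fun setT f ->
  (\int[mu (E S x)]_t f t = \int[mu x]_(t in S) f t)%E.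
Proof.
move=> mS mf; rewrite [LHS]integralE [RHS]integralE.
rewrite !ge0_integral_pvm_proj//; first exact: measurable_funeneg.
exact: measurable_funepos.
Qed.

Lemma integral_pvm_compl S x (f : measurableTypeR R -> \bar R) :
  measurable S -> measurable_fun setT f ->
  (\int[mu (x - E S x)%R]_t f t = \int[mu x]_(t in ~` S) f t)%E.
Proof.
move=> mS mf; rewrite [LHS]integralE [RHS]integralE.
rewrite !ge0_integral_pvm_compl//; first exact: measurable_funeneg.
exact: measurable_funepos.
Qed.

(** Unit shells turn an integrability condition on [pvm_mu E x] into a weighted
    sum of the numbers [`|E (shell n) x| ^+ 2] ([spectral_dom_series]), which
    can be compared for different vectors and depends continuously on [x]. *)
Definition shell n : set (measurableTypeR R) :=
  [set t : R | n%:R <= `|t| < n.+1%:R].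

Lemma shellE n : shell n = ((fun t : R => `|t|) @^-1` `[n%:R, n.+1%:R[%classic).
Proof. by apply/seteqP; split => t; rewrite /shell /= in_itv. Qed.

Lemma measurable_abs :
  measurable_fun (setT : set (measurableTypeR R)) (fun t : R => `|t|).
Proof. exact: measurableT_comp. Qed.

Lemma measurable_EFin_abs :
  measurable_fun (setT : set (measurableTypeR R)) (fun t : R => `|t|%:E).
Proof. by apply/measurable_EFinP; exact: measurable_abs. Qed.

Lemma measurable_shell n : measurable (shell n).
Proof.
rewrite shellE -[X in measurable X]setTI.
by apply: measurable_abs => //; exact: measurable_itv.
Qed.

Lemma shell_cover : \bigcup_n shell n = setT.
Proof.
apply/seteqP; split => // t _; exists (Num.trunc `|t|) => //=.
by rewrite /shell /= truncn_itv.
Qed.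

Lemma shell_disj : trivIset setT shell.
Proof.
apply/trivIsetP => i j _ _ ij; apply/seteqP; split => // t [].
rewrite /shell /= => /andP[i1 i2] /andP[j1 j2].
have := le_lt_trans i1 j2; have := le_lt_trans j1 i2; rewrite !ltr_nat.
by move: ij => /eqP; lia.
Qed.

Lemma integral_shells x (f : measurableTypeR R -> \bar R) :
  measurable_fun setT f -> (forall t, 0 <= f t)%E ->
  (\int[mu x]_t f t = \sum_(0 <= n <oo) \int[mu x]_(t in shell n) f t)%E.
Proof.
move=> mf f0; rewrite -{1}shell_cover ge0_integral_bigcup//.
- exact: measurable_shell.
- by rewrite shell_cover.
- exact: shell_disj.
Qed.

Lemma integral_shells_ge x (f : measurableTypeR R -> \bar R) (lo : nat -> R) N :
  measurable_fun setT f -> (forall t, 0 <= f t)%E -> (forall n, 0 <= lo n) ->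
  (forall n t, shell n t -> ((lo n)%:E <= f t)%E) ->
  ((\sum_(n < N) lo n * hnorm (E (shell n) x) ^+ 2)%:E <= \int[mu x]_t f t)%E.
Proof.
move=> mf f0 lo0 lof; rewrite integral_shells//.
apply: (@le_trans _ _ (\sum_(0 <= n < N) \int[mu x]_(t in shell n) f t)%E).
  rewrite big_mkord -sumEFin; apply: lee_sum => n _.
  rewrite EFinM -pvm_mu_hnorm; last exact: measurable_shell.
  rewrite -integral_cst; last exact: measurable_shell.
  apply: ge0_le_integral => //.
  - exact: measurable_shell.
  - by move=> t _ /=; rewrite lee_fin.
  - exact: measurable_funTS.
  - by move=> t; exact: lof.
by apply: nneseries_lim_ge => n _ _; apply: integral_ge0.
Qed.

Lemma integral_shells_le x (f : measurableTypeR R -> \bar R) (hi : nat -> R) :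
  measurable_fun setT f -> (forall t, 0 <= f t)%E -> (forall n, 0 <= hi n) ->
  (forall n t, shell n t -> (f t <= (hi n)%:E)%E) ->
  (\int[mu x]_t f t <=
   \sum_(0 <= n <oo) (hi n * hnorm (E (shell n) x) ^+ 2)%:E)%E.
Proof.
move=> mf f0 hi0 fhi; rewrite integral_shells//.
apply: lee_nneseries => [n _ _|n _]; first exact: integral_ge0.
rewrite EFinM -pvm_mu_hnorm; last exact: measurable_shell.
rewrite -integral_cst; last exact: measurable_shell.
apply: ge0_le_integral => //.
- exact: measurable_shell.
- exact: measurable_funTS.
- by move=> t; exact: fhi.
Qed.

Lemma bounded_shells x : bounded_sums (fun n => hnorm (E (shell n) x) ^+ 2).
Proof.
exists (hnorm x ^+ 2) => N.
rewrite -lee_fin -pvm_mu_setT -[leRHS]mul1e -integral_cst//.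
rewrite (eq_bigr (fun n : 'I_N => 1 * hnorm (E (shell n) x) ^+ 2)); last first.
  by move=> n _; rewrite mul1r.
by apply: (@integral_shells_ge x (cst 1%E) (fun=> 1)).
Qed.

Lemma measurable_abs_powR (s : R) :
  measurable_fun (setT : set (measurableTypeR R)) (fun t : R => (`|t| `^ s)%:E).
Proof.
apply/measurable_EFinP.
exact: (measurableT_comp (measurable_powR s) measurable_abs).
Qed.

(** On [shell n] the integrand lies between [n `^ (2 * s)] and
    [n.+1 `^ (2 * s)], and the latter is at most [2 `^ (2 * s)] times
    [n `^ (2 * s) + 1]. *)
Lemma spectral_dom_series s x : 0 <= s ->
  spectral_dom_abs_pow E s x <->
  bounded_sums (fun n => n.+1%:R `^ (2 * s) * hnorm (E (shell n) x) ^+ 2).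
Proof.
move=> s0; have s20 : 0 <= 2 * s by rewrite mulr_ge0.
have pos n : 0 <= n.+1%:R `^ (2 * s) * hnorm (E (shell n) x) ^+ 2.
  by rewrite mulr_ge0 ?powR_ge0 ?sqr_ge0.
split=> [h|/(nneseries_bounded_sums pos) h]; last first.
  apply: le_lt_trans h; apply: integral_shells_le => //.
  - exact: measurable_abs_powR.
  - by move=> n t /andP[_ h]; rewrite lee_fin ge0_ler_powR ?nnegrE// ltW.
have bnd (lo : nat -> R) : (forall n, 0 <= lo n) ->
    (forall n (t : R), shell n t -> lo n <= `|t| `^ (2 * s)) ->
    bounded_sums (fun n => lo n * hnorm (E (shell n) x) ^+ 2).
  move=> lo0 hlo; exists (fine (\int[mu x]_t (`|t| `^ (2 * s))%:E)) => N.
  rewrite -lee_fin fineK; last first.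
    by rewrite ge0_fin_numE// integral_ge0.
  by apply: integral_shells_ge => //; exact: measurable_abs_powR.
have b1 : bounded_sums (fun n => n%:R `^ (2 * s) * hnorm (E (shell n) x) ^+ 2).
  apply: bnd => [n|n t /andP[h1 _]]; first exact: powR_ge0.
  by rewrite ge0_ler_powR ?nnegrE.
have b0 := bounded_shells x.
have b2 := bounded_sums_scale (powR_ge0 2 (2 * s)) (bounded_sumsD b1 b0).
apply: bounded_sumsW b2 => n.
rewrite -[X in _ <= _ * (_ + X)]mul1r -mulrDl mulrA ler_wpM2r ?sqr_ge0//.
case: n => [|n].
  rewrite powR1 mulrDr mulr1 ler_wpDl ?mulr_ge0 ?powR_ge0//.
  by rewrite -[leLHS](powRr0 2) ler_powR// ler1n.
rewrite mulrDr ler_wpDr ?mulr1 ?powR_ge0// -powRM//.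
by rewrite ge0_ler_powR ?nnegrE ?mulr_ge0// -natrM ler_nat; lia.
Qed.

End Pvm.

(** * A skew-adjoint operator and its spectral measure *)

Section OperatorTheory.
Variables (R : realType) (H : completeNormedModType R[i]) (T : operator H).
Implicit Types x y : H.

Lemma domZ (a : R[i]) x : dom T x -> dom T (a *: x).
Proof.
by move=> dx; rewrite -[_ *: _]addr0; apply: dom_linear => //; exact: dom0.
Qed.
Lemma domD x y : dom T x -> dom T y -> dom T (x + y).
Proof. by move=> dx dy; rewrite -[x]scale1r; exact: dom_linear. Qed.
Lemma domB x y : dom T x -> dom T y -> dom T (x - y).
Proof. by move=> dx dy; rewrite -scaleN1r addrC; exact: dom_linear. Qed.
Lemma dom_sum (I : Type) (r : seq I) (F : I -> H) :
  (forall i, dom T (F i)) -> dom T (\sum_(i <- r) F i).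
Proof.
move=> h; elim: r => [|i r IH]; first by rewrite big_nil; exact: dom0.
by rewrite big_cons; exact: domD.
Qed.
Lemma opD x y : dom T x -> dom T y -> T (x + y) = T x + T y.
Proof. by move=> dx dy; have := op_linear 1 dx dy; rewrite !scale1r. Qed.
Lemma op0 : T 0 = 0.
Proof.
by apply: (addIr (T 0)); rewrite -opD ?add0r//; exact: dom0.
Qed.
Lemma opZ (a : R[i]) x : dom T x -> T (a *: x) = a *: T x.
Proof.
move=> dx; have := op_linear a dx (@dom0 _ _ T).
by rewrite op0 !addr0.
Qed.
Lemma opB x y : dom T x -> dom T y -> T (x - y) = T x - T y.
Proof.
move=> dx dy; rewrite -scaleN1r opD//; last exact: domZ.
by rewrite opZ// scaleN1r.
Qed.
Lemma op_sum (I : Type) (r : seq I) (F : I -> H) :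
  (forall i, dom T (F i)) -> T (\sum_(i <- r) F i) = \sum_(i <- r) T (F i).
Proof.
move=> h; elim: r => [|i r IH]; first by rewrite !big_nil op0.
by rewrite !big_cons opD ?IH//; exact: dom_sum.
Qed.

End OperatorTheory.

Section SpectralOperator.
Variables (R : realType) (H : completeNormedModType R[i]).
Variable dot : {dot H for Num.conj}.
Hypothesis hilb : is_hilbert dot.
Variables (T : operator H) (E : pvm dot).
Local Notation ip := (inner dot).
Local Notation Re := complex.Re.
Local Notation Im := complex.Im.
Local Notation normc := Normc.normc.
Local Notation hnorm := (@hnorm R H).
Local Notation hcvg := (@hcvg R H).
Local Notation mu := (pvm_mu E).
Hypothesis specT : spectral_measure T E.
Hypothesis skewT : forall x y, dom T x -> dom T y -> ip x (T y) = - ip (T x) y.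
Hypothesis denseT : dense (dom T).
Implicit Types (x y z : H) (S : set (measurableTypeR R)).

(** The quadratic form [<x, - i T x>]; by [Im_ip_op] it is also the imaginary
    part of [<x, T x>]. *)
Definition moment x : R := Rintegral (mu x) setT id.

Lemma domTE x : dom T x <-> (\int[mu x]_t (t ^+ 2)%:E < +oo)%E.
Proof. by rewrite specT.1. Qed.

Lemma Im_ip_op x : dom T x -> Im (ip x (T x)) = moment x.
Proof. by move=> dx; rewrite specT.2//= mul0r mul1r add0r. Qed.

Lemma measurable_EFin_id :
  measurable_fun (setT : set (measurableTypeR R)) (fun t : R => t%:E).
Proof. exact/measurable_EFinP. Qed.

Lemma measurable_sqr :
  measurable_fun (setT : set (measurableTypeR R)) (fun t : R => (t ^+ 2)%:E).
Proof. by apply/measurable_EFinP; exact: measurable_funX. Qed.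

(** The measure is finite and [`|t| <= 1 + t ^+ 2]. *)
Lemma integrable_moment x : dom T x -> (mu x).-integrable setT (EFin \o id).
Proof.
move=> /domTE dx; apply/integrableP; split; first exact/measurable_EFinP.
apply: (@le_lt_trans _ _ (\int[mu x]_t (1%:E + (t ^+ 2)%:E))%E).
  apply: ge0_le_integral => //.
  - by apply: measurableT_comp => //; exact/measurable_EFinP.
  - by apply: emeasurable_funD => //; exact: measurable_sqr.
  - move=> t _ /=; rewrite -EFinD lee_fin.
    rewrite -(real_normK (num_real t)).
    by have := sqr_ge0 (`|t| - 1); have := normr_ge0 t; nra.
rewrite ge0_integralD//; last 2 first.
- by move=> t _; rewrite lee_fin sqr_ge0.
- exact: measurable_sqr.
rewrite integral_cst// mul1e (pvm_mu_setT hilb).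
by apply: lte_add_pinfty => //; exact: ltry.
Qed.

Lemma dom_proj S x : measurable S -> dom T x -> dom T (E S x).
Proof.
move=> mS /domTE dx; apply/domTE; rewrite ge0_integral_pvm_proj//; first last.
- by move=> t; rewrite lee_fin sqr_ge0.
- exact: measurable_sqr.
apply: le_lt_trans dx; apply: ge0_subset_integral => //.
  exact: measurable_sqr.
by move=> t _; rewrite lee_fin sqr_ge0.
Qed.

Lemma moment_proj S x : measurable S ->
  moment (E S x) = Rintegral (mu x) S id.
Proof.
move=> mS; rewrite /moment /Rintegral.
by rewrite (integral_pvm_proj hilb E x mS measurable_EFin_id).
Qed.

Lemma moment_split S x : measurable S -> dom T x ->
  moment x = moment (E S x) + moment (x - E S x).
Proof.
move=> mS dx; rewrite moment_proj//.
rewrite [in X in _ + X]/moment /Rintegral.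
rewrite (integral_pvm_compl hilb E x mS measurable_EFin_id).
rewrite -/(Rintegral _ S id) -/(Rintegral _ (~` S) id) -Rintegral_setU ?setUv//.
- exact: measurableC.
- exact: integrable_moment.
- by apply/disj_setPCl.
Qed.

(** Skewness makes the imaginary part of [<x, T y>] symmetric in [x] and [y], so
    that two of the four terms of the polarization identity suffice. *)
Lemma moment_polar x y : dom T x -> dom T y ->
  4 * Im (ip x (T y)) = moment (x + y) - moment (x - y).
Proof.
move=> dx dy; rewrite -!Im_ip_op; [|exact: domB|exact: domD].
rewrite opD// opB// !(ipDl, ipDr, ipNl, ipNr).
have -> : ip y (T x) = - conjc (ip x (T y)) by rewrite skewT// -ipC.
by rewrite !(ImD, ImN, ImJ); ring.
Qed.

(** The form [moment] is the sum of its restrictions to the range of [E S] and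
    to the orthogonal complement; by polarization so is the imaginary part of
    [<x, T z>]. Hence [<x, T (E S y) - E S (T y)>] has imaginary part [0] for
    all [x] in the domain of [T], and replacing [x] by [i x] its real part
    vanishes too. *)
Lemma op_proj S y : measurable S -> dom T y -> T (E S y) = E S (T y).
Proof.
move=> mS dy; have dEy : dom T (E S y) by exact: dom_proj.
have split x z : dom T x -> dom T z -> Im (ip x (T z)) =
    Im (ip (E S x) (T (E S z))) + Im (ip (x - E S x) (T (z - E S z))).
  move=> dx dz.
  have dEx : dom T (E S x) by exact: dom_proj.
  have dEz : dom T (E S z) by exact: dom_proj.
  have dFx : dom T (x - E S x) by exact: domB.
  have dFz : dom T (z - E S z) by exact: domB.
  have := moment_polar dx dz; have := moment_polar dEx dEz.
  have := moment_polar dFx dFz.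
  have := moment_split mS (domD dx dz); have := moment_split mS (domB dx dz).
  rewrite (pvmD E x z mS) (pvmB E x z mS) => e1 e2.
  have eD : x - E S x + (z - E S z) = x + z - (E S x + E S z).
    by rewrite opprD addrACA.
  have eB : x - E S x - (z - E S z) = x - z - (E S x - E S z).
    by rewrite !opprD addrACA.
  by rewrite eD eB; lra.
have comm x : dom T x -> Im (ip x (T (E S y) - E S (T y))) = 0.
  move=> dx; have dEx : dom T (E S x) by exact: dom_proj.
  rewrite ipBr ImD ImN pvm_sym// (split x)// (split (E S x) y)//.
  by rewrite !pvm_idem// !subrr op0 ip0r ip0l; ring.
apply/eqP; rewrite -subr_eq0; apply/eqP.
apply: (dense_orth hilb denseT) => x dx.
have := comm _ dx; have := comm _ (domZ 'i%C dx).
rewrite ipZl; case: (ip _ _) => a b /=; rewrite mul0r add0r mulN1r.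
by move=> /eqP; rewrite oppr_eq0 => /eqP -> ->.
Qed.

Lemma dom_proj_bounded (b : R) S v : measurable S ->
  (forall t : R, S t -> `|t| <= b) -> dom T (E S v).
Proof.
move=> mS Sb; apply/domTE; rewrite ge0_integral_pvm_proj//; first last.
- by move=> t; rewrite lee_fin sqr_ge0.
- exact: measurable_sqr.
apply: (@le_lt_trans _ _ (\int[mu v]_(t in S) (b ^+ 2)%:E)%E).
  apply: ge0_le_integral => //.
  - by move=> t _; rewrite lee_fin sqr_ge0.
  - exact: measurable_funTS measurable_sqr.
  - move=> t /Sb tb; rewrite lee_fin -real_normK ?num_real// lerXn2r ?nnegrE//.
    exact: le_trans tb.
rewrite integral_cst// pvm_mu_hnorm// -EFinM; exact: ltry.
Qed.

Lemma moment_proj_bounds (a b : R) S v : measurable S ->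
  (forall t : R, S t -> a <= t <= b) ->
  a * hnorm (E S v) ^+ 2 <= moment (E S v) <= b * hnorm (E S v) ^+ 2.
Proof.
move=> mS Sab.
have iS : (mu v).-integrable S (EFin \o id).
  have dv : dom T (E S v).
    apply: (@dom_proj_bounded (`|a| + `|b|)) => // t /Sab /andP[h1 h2].
    rewrite ler_norml; apply/andP; split.
      by have := ler_norm (- a); rewrite normrN; have := normr_ge0 b; lra.
    by have := ler_norm b; have := normr_ge0 a; lra.
  have /integrableP[m h] := integrable_moment dv.
  apply/integrableP; split; first exact: measurable_funTS.
  rewrite ge0_integral_pvm_proj// in h.
  by apply: measurableT_comp.
have ic c : (mu v).-integrable S (EFin \o cst c).
  apply/integrableP; split.
    by apply/measurable_EFinP.
  rewrite /= integral_cst// pvm_mu_hnorm//; exact: ltry.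
have e c : c * hnorm (E S v) ^+ 2 = Rintegral (mu v) S (cst c).
  by rewrite Rintegral_cst// pvm_mu_hnorm.
rewrite moment_proj// !e; apply/andP; split.
  apply: le_Rintegral => //; first exact: ic.
  by move=> t /Sab /andP[].
apply: le_Rintegral => //; first exact: ic.
by move=> t /Sab /andP[].
Qed.

(** The norm of a symmetric operator is its numerical radius. Polarizing
    [moment] at [z = E S x] and [- i T z / b] gives
    [4 * (`|T z| ^+ 2 / b) <= b * (2 * (`|T z| ^+ 2 / b ^+ 2 + `|z| ^+ 2))]. *)
Lemma op_proj_upper (b : R) S x : measurable S -> 0 < b ->
  (forall t : R, S t -> `|t| <= b) -> dom T x ->
  hnorm (T (E S x)) <= b * hnorm (E S x).
Proof.
move=> mS b0 Sb dx; set z := E S x; set n := hnorm (T z).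
have SN (t : R) : S t -> - b <= t <= b by move=> /Sb; rewrite ler_norml.
have dz : dom T z by exact: dom_proj.
(* The range of [E S] is invariant under [T], so this vector may be polarized
   against [x] after projection. *)
pose v := (b^-1)%:C *: (- 'i%C *: T x).
have vE : E S v = (b^-1)%:C *: (- 'i%C *: T z).
  by rewrite /v !pvmZ// /z op_proj.
have dv : dom T (E S v) by exact: dom_proj_bounded Sb.
have := moment_polar dv dz.
rewrite -(pvmD E v x mS) -(pvmB E v x mS) {1}vE !ipZl (ipxx hilb) -/n.
have /andP[_ h1] := moment_proj_bounds (v + x) mS SN.
have /andP[h2 _] := moment_proj_bounds (v - x) mS SN.
have par : hnorm (E S (v + x)) ^+ 2 + hnorm (E S (v - x)) ^+ 2 =
   2 * ((b^-1 * n) ^+ 2 + hnorm z ^+ 2).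
  have -> : (b^-1 * n) ^+ 2 = hnorm (E S v) ^+ 2.
    rewrite vE !hnormZ// normc_real normcN gtr0_norm ?invr_gt0//.
    by rewrite /= expr0n expr1n add0r sqrtr1 mul1r.
  rewrite (pvmD E v x mS) (pvmB E v x mS) -/z !(hnorm_sq hilb).
  rewrite !(ipDl, ipDr, ipNl, ipNr).
  by rewrite !(ReD, ReN); ring.
have -> : Im ((b^-1)%:C^*%C * ((- 'i)^*%C * (n ^+ 2)%:C)) = b^-1 * n ^+ 2.
  by rewrite /= ; ring.
move=> e.
have : 4 * (b^-1 * n ^+ 2) <= b * (2 * ((b^-1 * n) ^+ 2 + hnorm z ^+ 2)).
  by rewrite e -par; lra.
have -> : b * (2 * ((b^-1 * n) ^+ 2 + hnorm z ^+ 2)) =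
  2 * (b^-1 * n ^+ 2) + 2 * b * hnorm z ^+ 2 by field; exact: lt0r_neq0.
move=> h; rewrite -ler_sqr ?nnegrE ?hnorm_ge0 ?mulr_ge0 ?hnorm_ge0 ?(ltW b0)//.
have : b^-1 * n ^+ 2 <= b * hnorm z ^+ 2 by lra.
by rewrite ler_pdivrMl// exprMn mulrA -expr2.
Qed.

(** Since [t] has constant sign on [S], no cancellation occurs in [moment]:
    [a * `|z| ^+ 2 <= `|<z, T z>| <= `|z| * `|T z|]. *)
Lemma op_proj_lower (a b : R) S x : measurable S -> 0 <= a ->
  (forall t : R, S t -> a <= t <= b) \/ (forall t : R, S t -> - b <= t <= - a) ->
  dom T x -> a * hnorm (E S x) <= hnorm (T (E S x)).
Proof.
move=> mS a0 Sab dx; set z := E S x.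
have dz : dom T z by exact: dom_proj.
have h : a * hnorm z ^+ 2 <= `|moment z|.
  case: Sab => /(moment_proj_bounds x mS) /andP[h1 h2].
    exact: le_trans h1 (ler_norm _).
  by rewrite -normrN (le_trans _ (ler_norm _))// lerNr -mulNr.
have : a * hnorm z ^+ 2 <= hnorm z * hnorm (T z).
  by apply: le_trans h _; rewrite -Im_ip_op//; exact: Im_ip_le.
have [->|z0] := eqVneq (hnorm z) 0; first by rewrite mulr0 hnorm_ge0.
by rewrite expr2 mulrCA ler_pM2l// lt_neqAle eq_sym z0 hnorm_ge0.
Qed.

(** The two halves of the shell, where [t] has a constant sign, are treated
    separately and added by orthogonality. *)
Lemma shell_op_ge n x : dom T x ->
  n%:R ^+ 2 * hnorm (E (shell n) x) ^+ 2 <= hnorm (E (shell n) (T x)) ^+ 2.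
Proof.
move=> dx.
pose P : set (measurableTypeR R) := [set t : R | 0 <= t].
pose N : set (measurableTypeR R) := [set t : R | t < 0].
have mP : measurable (shell n `&` P).
  apply: measurableI; first exact: measurable_shell.
  have -> : P = [set` `[0 : R, +oo[]; last exact: measurable_itv.
  by apply/seteqP; split => t /=; rewrite in_itv /= andbT.
have mN : measurable (shell n `&` N).
  apply: measurableI; first exact: measurable_shell.
  have -> : N = [set` `]-oo, 0 : R[]; last exact: measurable_itv.
  by apply/seteqP; split => t /=; rewrite in_itv.
have d : [disjoint (shell n `&` P) & (shell n `&` N)].
  apply/disj_set2P; apply/seteqP; split => // t [[_ h1] [_ h2]].
  by have := le_lt_trans h1 h2; rewrite ltxx.
have -> : @shell R n = (shell n `&` P) `|` (shell n `&` N).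
  rewrite -setIUr; apply/esym/setIidPl => t _.
  by rewrite /P /N /=; case: (lerP 0 t); [left|right].
rewrite !(hnorm_pvmU hilb)// mulrDr -!op_proj// -!exprMn lerD//.
  rewrite lerXn2r ?nnegrE ?mulr_ge0 ?hnorm_ge0//.
  apply: (op_proj_lower (b := n.+1%:R)) => //; left => t [/andP[+ +] /=].
  by rewrite /P /= => + + t0; rewrite ger0_norm// => -> /ltW.
rewrite lerXn2r ?nnegrE ?mulr_ge0 ?hnorm_ge0//.
apply: (op_proj_lower (b := n.+1%:R)) => //; right => t [/andP[+ +] /=].
rewrite /N /= => + + t0; rewrite ltr0_norm// => h1 h2.
by rewrite lerNl (ltW h2) lerNr h1.
Qed.

Lemma shell_op_le n x : dom T x ->
  hnorm (E (shell n) (T x)) ^+ 2 <= n.+1%:R ^+ 2 * hnorm (E (shell n) x) ^+ 2.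
Proof.
move=> dx; have mS := (@measurable_shell R n).
rewrite -op_proj// -exprMn lerXn2r ?nnegrE ?mulr_ge0 ?hnorm_ge0//.
by apply: op_proj_upper => // t /andP[_ /ltW].
Qed.

Lemma dom_spectral1 x : dom T x <-> spectral_dom_abs_pow E 1 x.
Proof.
have e : (\int[mu x]_t (`|t| `^ (2 * 1))%:E = \int[mu x]_t (t ^+ 2)%:E)%E.
  apply: eq_integral => t _; rewrite mulr1 powR_mulrn ?normr_ge0//.
  by rewrite real_normK ?num_real.
by rewrite domTE /spectral_dom_abs_pow /= e.
Qed.

(** The domain of [`|T| ^ (s + 1)] consists of the [x] such that [T x] lies in
    the domain of [`|T| ^ s]: on [shell n] the operator [T] multiplies norms by
    a factor between [n] and [n.+1]. *)
Lemma spectral_dom_succ s x : 0 <= s ->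
  spectral_dom_abs_pow E (s + 1) x <->
  dom T x /\ spectral_dom_abs_pow E s (T x).
Proof.
move=> s0; have s1 : 0 <= s + 1 by lra.
pose c y n := hnorm (E (shell n) y) ^+ 2.
have c0 y n : 0 <= c y n by exact: sqr_ge0.
pose w n : R := n.+1%:R `^ (2 * s).
have w0 n : 0 <= w n by exact: powR_ge0.
have wE n : n.+1%:R `^ (2 * (s + 1)) = n.+1%:R ^+ 2 * w n.
  rewrite mulrDr mulr1 powRD ?pnatr_eq0 ?implybT// mulrC.
  by rewrite powR_mulrn.
rewrite (spectral_dom_series hilb E x s1) (spectral_dom_series hilb E _ s0).
have -> : (fun n => n.+1%:R `^ (2 * (s + 1)) * c x n) =
    (fun n => n.+1%:R ^+ 2 * w n * c x n).
  by apply/funext => n; rewrite wE.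
split=> [b|[dx b]].
  have dx : dom T x.
    apply/dom_spectral1/(spectral_dom_series hilb) => //.
    apply: bounded_sumsW b => n; rewrite ler_wpM2r ?sqr_ge0//.
    rewrite mulr1 powR_mulrn// ler_peMr ?sqr_ge0//.
    by rewrite -[leLHS](powRr0 n.+1%:R) ler_powR ?ler1n// mulr_ge0.
  split=> //; apply: bounded_sumsW b => n.
  by rewrite [_ ^+ 2 * w n]mulrC -mulrA ler_wpM2l//; exact: shell_op_le.
have b0 : bounded_sums (c x).
  have : spectral_dom_abs_pow E 1 x by exact/dom_spectral1.
  move/(spectral_dom_series hilb E x ler01); apply: bounded_sumsW => n.
  rewrite ler_peMl ?sqr_ge0// -[leLHS](powRr0 n.+1%:R) ler_powR ?ler1n// mulr_ge0//.
have b4 := bounded_sums_scale (_ : 0 <= 4) b.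
have b5 := bounded_sumsD (b4 _) b0.
apply: bounded_sumsW (b5 _) => // n; case: n => [|n].
  by rewrite /w powR1 expr1n !mul1r lerDr mulr_ge0 ?sqr_ge0.
apply: ler_wpDr => //.
apply: (@le_trans _ _ (4 * (w n.+1 * (n.+1%:R ^+ 2 * c x n.+1)))); last first.
  by rewrite ler_wpM2l// ler_wpM2l//; exact: shell_op_ge.
rewrite [leRHS](_ : _ = 4 * n.+1%:R ^+ 2 * w n.+1 * c x n.+1); last by ring.
rewrite !ler_wpM2r// -!natrX -natrM ler_nat; nia.
Qed.

End SpectralOperator.

(** * The square root of the modulus *)

Section HalfPower.
Variables (R : realType) (H : completeNormedModType R[i]).
Variable dot : {dot H for Num.conj}.
Hypothesis hilb : is_hilbert dot.
Variables (T : operator H) (E : pvm dot).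
Local Notation hnorm := (@hnorm R H).
Local Notation hcvg := (@hcvg R H).
Local Notation mu := (pvm_mu E).
Local Notation moment := (moment E).
Local Notation absr := (fun t : R => `|t|).
Hypothesis specT : spectral_measure T E.
Implicit Types (x y z : H) (S : set (measurableTypeR R)).

Lemma integrable_abs x : dom T x -> (mu x).-integrable setT (EFin \o absr).
Proof. by move=> /(integrable_moment hilb specT) /integrable_norm. Qed.

(** The sum is at most the integral of [`|t|], and
    [`|t| = - t + 2 * (t * (0 <= t))]. The positive part of [t] contributes
    [moment (E P x)] with [P = [set t | 0 <= t]], which the upper bound on the
    form controls. *)
Lemma sum_shells_le_moment (C : R) x : 0 <= C ->
  (forall z, dom T z -> moment z <= C * hnorm z ^+ 2) -> dom T x ->
  forall N, \sum_(n < N) n%:R * hnorm (E (shell n) x) ^+ 2 <=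
    - moment x + 2 * C * hnorm x ^+ 2.
Proof.
move=> C0 bnd dx N.
pose P : set (measurableTypeR R) := [set t : R | 0 <= t].
have mP : measurable P.
  have -> : P = [set` `[0 : R, +oo[]; last exact: measurable_itv.
  by apply/seteqP; split => t /=; rewrite in_itv /= andbT.
have mC : measurable (~` P) by exact: measurableC.
have iid := integrable_moment hilb specT dx; have iab := integrable_abs dx.
have d : [disjoint P & ~` P] by apply/disj_setPCl.
have splitR (f : measurableTypeR R -> R) : (mu x).-integrable setT (EFin \o f) ->
    Rintegral (mu x) setT f = Rintegral (mu x) P f + Rintegral (mu x) (~` P) f.
  by move=> fi; rewrite -Rintegral_setU ?setUv.
have absP : Rintegral (mu x) P absr = moment (E P x).
  rewrite (moment_proj hilb)//; apply: eq_Rintegral => t; rewrite inE /P /= => t0.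
  by rewrite ger0_norm.
have absC : Rintegral (mu x) (~` P) absr = - Rintegral (mu x) (~` P) id.
  rewrite -mulN1r -RintegralZl//; last exact: integrableS iid.
  apply: eq_Rintegral => t; rewrite inE /P /= => /negP; rewrite -ltNge => t0.
  by rewrite ltr0_norm// mulN1r.
have mE : moment x = moment (E P x) + Rintegral (mu x) (~` P) id.
  by rewrite (moment_proj hilb)// -splitR.
have b1 : moment (E P x) <= C * hnorm x ^+ 2.
  apply: le_trans (bnd _ (dom_proj hilb specT mP dx)) _.
  by rewrite ler_wpM2l// lerXn2r ?nnegrE ?hnorm_ge0 ?hnorm_pvm_le.
apply: (@le_trans _ _ (Rintegral (mu x) setT absr)); last first.
  by rewrite splitR// absP absC; lra.
rewrite -lee_fin /Rintegral fineK; last exact: integrable_fin_num.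
apply: (integral_shells_ge hilb) => //.
  exact: measurable_EFin_abs.
by move=> n t /andP[h _]; rewrite lee_fin.
Qed.

(** The cut-offs [E [set t | `|t| <= N] x] lie in the domain of [T], and
    Markov's inequality for [`|t|] shows that they converge to [x]. *)
Lemma spectral_half_approx x : spectral_dom_abs_pow E (1 / 2) x ->
  exists M, exists2 f : nat -> H, hcvg f x &
    forall N, [/\ dom T (f N), - moment (f N) <= M & hnorm (f N) <= hnorm x].
Proof.
have e : (\int[mu x]_t (`|t| `^ (2 * (1 / 2)))%:E = \int[mu x]_t (`|t|)%:E)%E.
  apply: eq_integral => t _; rewrite mulrCA divff// mulr1 powRr1 ?normr_ge0//.
rewrite /spectral_dom_abs_pow /= e => fin.
have mabs : measurable_fun (setT : set (measurableTypeR R)) (fun t : R => `|t|%:E).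
  exact: measurable_EFin_abs.
have M0 : (0 <= \int[mu x]_t (`|t|)%:E)%E.
  by apply: integral_ge0 => t _; rewrite lee_fin.
pose M := fine (\int[mu x]_t (`|t|)%:E)%E.
have ME : (M%:E = \int[mu x]_t (`|t|)%:E)%E by rewrite fineK// ge0_fin_numE.
have iab : (mu x).-integrable setT (EFin \o absr).
  apply/integrableP; split => //=.
  by under eq_integral do rewrite normr_id.
have iid : (mu x).-integrable setT (EFin \o id).
  apply: le_integrable iab => //; first exact/measurable_EFinP.
  by move=> t _ /=; rewrite normr_id.
pose B N : set (measurableTypeR R) := [set t : R | `|t| <= N%:R].
have mB N : measurable (B N).
  have -> : B N = ((fun t : R => `|t|) @^-1` `]-oo, N%:R]%classic).
    by apply/seteqP; split => t; rewrite /B /= in_itv.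
  rewrite -[X in measurable X]setTI.
  by apply: measurable_abs => //; exact: measurable_itv.
exists M, (fun N => E (B N) x); last first.
  move=> N; split; [|  |exact: hnorm_pvm_le].
    exact: (dom_proj_bounded hilb specT x (mB N) (fun t => id)).
  rewrite (moment_proj hilb)//.
  have iS : (mu x).-integrable (B N) (EFin \o id) by exact: integrableS iid.
  apply: le_trans (ler_norm _) _; rewrite normrN.
  apply: le_trans (le_normr_Rintegral (mB N) iS) _.
  rewrite -lee_fin ME /Rintegral fineK; last first.
    by apply: integrable_fin_num => //; exact: integrableS iab.
  by apply: ge0_subset_integral => // t _; rewrite lee_fin.
apply/hcvg_near => eps eps0.
have tail n : n%:R * hnorm (E (B n) x - x) ^+ 2 <= M.
  rewrite hnorm_distC -lee_fin ME EFinM -(pvm_mu_setT hilb E).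
  rewrite (pvm_mu_compl hilb)// setTD -integral_cst//; last exact: measurableC.
  apply: (@le_trans _ _ (\int[mu x]_(t in ~` B n) `|t|%:E)%E).
    apply: ge0_le_integral => //.
    - exact: measurableC.
    - by move=> t _; rewrite lee_fin.
    - exact: measurable_funTS.
    - by move=> t /= /negP; rewrite /B /= -ltNge lee_fin => /ltW.
  apply: ge0_subset_integral => //; first exact: measurableC.
pose N0 := (Num.trunc (M / eps ^+ 2)).+1.
have N0M : M < N0%:R * eps ^+ 2.
  by rewrite -ltr_pdivrMr ?exprn_gt0// truncnS_gt.
exists N0 => n nN0.
have := tail n; set h := hnorm _ => hM.
have h0 : 0 <= h by exact: hnorm_ge0.
rewrite -ltr_sqr ?nnegrE ?(ltW eps0)//.
have : N0%:R * h ^+ 2 < N0%:R * eps ^+ 2.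
  apply: le_lt_trans N0M; apply: le_trans hM.
  by rewrite ler_wpM2r ?sqr_ge0// ler_nat.
by rewrite ltr_pM2l.
Qed.

End HalfPower.

(** * Skew-adjoint closures *)

Lemma ip_lim_unique (R : realType) (H : completeNormedModType R[i])
    (dot : {dot H for Num.conj}) (f g : nat -> H) a b x z : is_hilbert dot ->
  hcvg f x -> hcvg g z ->
  (forall n, inner dot a (f n) = inner dot b (g n)) ->
  inner dot a x = inner dot b z.
Proof.
move=> hilb fx gz e; apply/eqP; rewrite eq_complex; apply/andP; split; apply/eqP.
  have h := hcvg_Re_ip hilb (y := a) fx.
  apply: (cvg_unique (@Rhausdorff R) h).
  rewrite (_ : (fun n => _) = (fun n => complex.Re (inner dot b (g n)))).
    exact: hcvg_Re_ip.
  by apply/funext => n; rewrite e.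
have h := hcvg_Im_ip hilb (y := a) fx.
apply: (cvg_unique (@Rhausdorff R) h).
rewrite (_ : (fun n => _) = (fun n => complex.Im (inner dot b (g n)))).
  exact: hcvg_Im_ip.
by apply/funext => n; rewrite e.
Qed.

Section SkewAdjoint.
Variables (R : realType) (H : completeNormedModType R[i]).
Variable dot : {dot H for Num.conj}.
Local Notation ip := (inner dot).

Lemma skew_adjoint_skew (T : operator H) x y : skew_adjoint dot T ->
  dom T x -> dom T y -> ip x (T y) = - ip (T x) y.
Proof.
move=> [_ e] dx dy; have : adjoint_graph dot T (x, - T x) by rewrite e.
by move=> /(_ y dy) /= ->; rewrite ipNl.
Qed.

Variables (S T : operator H).
Hypothesis clT : is_closure S T.

Lemma closure_extends x : dom S x -> dom T x /\ T x = S x.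
Proof.
move=> dx; have : graph T (x, S x) by rewrite clT; apply: subset_closure.
by move=> [/= ? ->].
Qed.

Hypothesis esaS : essentially_skew_adjoint dot S.

(** An operator is determined by its graph up to its values outside its domain,
    so [T] inherits skew-adjointness from the closure provided by [esaS]. *)
Lemma closure_skew_adjoint : skew_adjoint dot T.
Proof.
have [T' clT' [T'd T'a]] := esaS.
have gE : graph T = graph T' by rewrite clT clT'.
have dE : dom T = dom T'.
  apply/seteqP; split => x dx.
    by have : graph T (x, T x) by []; rewrite gE => -[].
  by have : graph T' (x, T' x) by []; rewrite -gE => -[].
have oE x : dom T x -> T x = T' x.
  move=> dx; have : graph T (x, T x) by [].
  by rewrite gE => -[].
split; first by rewrite dE.
have -> : adjoint_graph dot T = adjoint_graph dot T'.
  apply/seteqP; split => p h y dy.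
    have dy' : dom T y by rewrite dE.
    by rewrite -oE//; exact: h.
  have dy' : dom T' y by rewrite -dE.
  by rewrite oE//; exact: h.
rewrite T'a; apply/seteqP; split => p [/= dp ->]; split => //.
- by rewrite dE.
- by rewrite oE ?dE.
- by rewrite -dE.
- by rewrite oE.
Qed.

End SkewAdjoint.

(** * Tri-diagonal systems *)

Section System.
Variables (R : realType) (H : completeNormedModType R[i]).
Variable dot : {dot H for Num.conj}.
Hypothesis hilb : is_hilbert dot.
Variables (A B : operator H) (lam : nat -> R) (phi : nat -> H).
Hypothesis tri_sys : tri_diagonal_system dot A B lam phi.
Local Notation ip := (inner dot).
Local Notation Re := complex.Re.
Local Notation Im := complex.Im.
Local Notation normc := Normc.normc.
Local Notation hnorm := (@hnorm R H).
Local Notation hcvg := (@hcvg R H).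
Local Notation b := (coupling dot B phi).
Local Notation coef := (coef dot phi).
Local Notation psum := (psum phi).
Local Notation Hs := (dom_abs_pow dot lam phi).
Let qs := tri_sys.1.
Let basis := qs_basis qs.
Let lam_gt0 := qs_lam_gt0 qs.
Implicit Types x y z : H.

Lemma lam_le m n : (m <= n)%N -> lam m <= lam n.
Proof. by move=> mn; exact: (qs_lam_nd qs). Qed.

Lemma lam_ge0 n : 0 <= lam n. Proof. exact: ltW. Qed.

Definition abs_coef x n : R := normc (coef x n).

Lemma abs_coef_ge0 x n : 0 <= abs_coef x n. Proof. exact: normc_ge0. Qed.

Lemma HsE s x : Hs s x <->
  bounded_sums (fun n => lam n `^ (2 * s) * abs_coef x n ^+ 2).
Proof.
rewrite -nneseries_bounded_sums// => n.
by rewrite mulr_ge0 ?powR_ge0 ?sqr_ge0.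
Qed.

Lemma skewA x y : dom A x -> dom A y -> ip x (A y) = - ip (A x) y.
Proof. exact: skew_adjoint_skew (qs_skew qs). Qed.

Lemma perturb_dom u x : dom A x -> dom (perturb A B u) x.
Proof. by move=> dx; split => //; exact: (qs_dom qs). Qed.

(** Both [A] and the closure of [A + B] are skew; subtract. *)
Lemma skewB x y : dom A x -> dom A y -> ip x (B y) = - ip (B x) y.
Proof.
move=> dx dy; have [T clT skT] := qs_esa qs 1.
have [dTx Tx] := closure_extends clT (perturb_dom 1 dx).
have [dTy Ty] := closure_extends clT (perturb_dom 1 dy).
have := skew_adjoint_skew skT dTx dTy.
rewrite Tx Ty /= !scale1r ipDl ipDr (skewA dx dy) opprD.
by move=> /addrI.
Qed.

Lemma b_skew j k : b k j = - conjc (b j k).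
Proof.
by rewrite /coupling (skewB (qs_phi_dom qs k) (qs_phi_dom qs j)) ipC.
Qed.

Lemma normc_b_sym j k : normc (b k j) = normc (b j k).
Proof. by rewrite b_skew normcN normc_conj. Qed.

(** The [n]-th coordinate of [B x], read off the matrix of [B]. The sum is finite
    and makes sense for every [x] in [H], whether or not [B x] does. *)
Definition Bcoef x n : R[i] := \sum_(j < n.+2) b n j * coef x j.

(** [B (phi n)] is the combination of at most three basis vectors. *)
Lemma ip_Bphi n x : ip (B (phi n)) x = - Bcoef x n.
Proof.
have -> : B (phi n) = psum (coef (B (phi n))) n.+2.
  apply: (coef_inj hilb basis) => j; rewrite (coef_psum basis).
  by case: ltnP => // nj; apply: tri_sys.2; lia.
rewrite (ip_psuml dot) -sumrN; apply: eq_bigr => j _.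
by rewrite (b_skew j n) mulNr opprK.
Qed.

Lemma Bcoef0 x : Bcoef x 0 = b 0%N 0%N * coef x 0 + b 0%N 1%N * coef x 1.
Proof. by rewrite /Bcoef !big_ord_recr big_ord0 /= add0r. Qed.

Lemma BcoefS x n : Bcoef x n.+1 = b n.+1 n * coef x n +
  b n.+1 n.+1 * coef x n.+1 + b n.+1 n.+2 * coef x n.+2.
Proof.
rewrite /Bcoef !big_ord_recr /= big1 ?add0r// => j _.
by rewrite tri_sys.2 ?mul0r//; have := ltn_ord j; lia.
Qed.

Lemma normc_Bcoef_le (e : R) x n : normc (b n n.-1) <= e -> normc (b n n) <= e ->
  normc (b n n.+1) <= e ->
  normc (Bcoef x n) <= e * (abs_coef x n.-1 + abs_coef x n + abs_coef x n.+1).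
Proof.
have step (z w : R[i]) (r s : R) : normc z <= r -> normc w <= s ->
    normc (z + w) <= r + s.
  by move=> zr ws; apply: le_trans (le_normcD _ _) (lerD zr ws).
have term j : normc (b n j) <= e -> normc (b n j * coef x j) <= e * abs_coef x j.
  by move=> h; rewrite Normc.normcM ler_wpM2r// abs_coef_ge0.
case: n term => [|n] term h1 h2 h3.
  have e0 : 0 <= e by apply: le_trans h1; exact: normc_ge0.
  rewrite Bcoef0 -addrA !mulrDr ler_wpDl ?mulr_ge0 ?abs_coef_ge0//.
  by apply: step; exact: term.
by rewrite BcoefS !mulrDr; apply: (step); [apply: (step)|]; exact: term.
Qed.

Lemma conjc_ilam n : conjc (- 'i%C * (lam n)%:C) = 'i%C * (lam n)%:C :> R[i].
Proof.
apply/eqP; rewrite eq_complex /=.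
by rewrite !(mul0r, mulr0, oppr0, subr0, add0r, addr0, opprK, mulNr, mul1r) !eqxx.
Qed.

(** Skewness moves [T] onto [phi n], where it is [A + u B]; no approximation of
    [x] by vectors of the domain of [A] is needed. *)
Lemma coef_closure u T x n : is_closure (perturb A B u) T -> dom T x ->
  coef (T x) n = - ('i%C * (lam n)%:C * coef x n) + u%:C * Bcoef x n.
Proof.
move=> clT dx; have skT := closure_skew_adjoint clT (qs_esa qs u).
have [dphi Tphi] := closure_extends clT (perturb_dom u (qs_phi_dom qs n)).
rewrite -[LHS]/(ip (phi n) (T x)) (skew_adjoint_skew skT dphi dx) Tphi /=.
rewrite ipDl (qs_eigen qs).
rewrite !ipZl ip_Bphi conjc_real -/(coef x n).
rewrite conjc_ilam.
by rewrite opprD mulrN opprK.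
Qed.

Lemma coef_B x n : dom A x -> coef (B x) n = Bcoef x n.
Proof.
move=> dx; rewrite -[LHS]/(ip (phi n) (B x)) (skewB (qs_phi_dom qs n) dx) ip_Bphi.
by rewrite opprK.
Qed.

Lemma normc_ilam n (z : R[i]) : normc ('i%C * (lam n)%:C * z) = lam n * normc z.
Proof.
rewrite !Normc.normcM normc_real ger0_norm ?lam_ge0//=.
by rewrite expr0n expr1n add0r sqrtr1 mul1r.
Qed.

Lemma psum_domA c N : dom A (psum c N).
Proof. by apply: dom_sum => i; apply: domZ; exact: (qs_phi_dom qs). Qed.

(** A skew-adjoint operator has no proper skew extension: it suffices that the
    vector [z] with coordinates [- i lam n <phi n, x>] satisfies
    [<x, A y> = - <z, y>] for [y] in the domain of [A], and this passes to the
    limit from Fourier sums. *)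
Lemma Hs_domA x : Hs 1 x -> dom A x.
Proof.
move=> /HsE h; pose c n := - 'i%C * (lam n)%:C * coef x n.
have [z zc coefz] : exists2 z, hcvg (psum c) z & coef z =1 c.
  apply: (riesz_fischer hilb basis); apply: bounded_sumsW h => n.
  rewrite /c !mulNr normcN normc_ilam exprMn mulr1 powR_mulrn ?lam_ge0//.
suff : adjoint_graph dot A (x, - z) by rewrite (qs_skew qs).2 => -[].
move=> y dy /=; rewrite ipC [RHS]ipC; congr conjc; rewrite ipNr -ipNl.
apply: (ip_lim_unique hilb (psum_coef_cvg hilb basis x) zc) => N.
rewrite ipC (skewA (psum_domA _ _) dy) rmorphN /= -ipC ipNl; congr (- ip _ _).
rewrite op_sum => [|i]; last by apply: domZ; exact: (qs_phi_dom qs).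
apply: eq_bigr => i _; rewrite opZ ?(qs_eigen qs) ?scalerA 1?mulrC//.
exact: (qs_phi_dom qs).
Qed.


Variable L : R.
Hypothesis L_ge0 : 0 <= L.
Hypothesis lam_ratio : forall n, lam n.+1 <= L * lam n.
Hypothesis b_small : forall e : R, 0 < e -> exists N0, forall n, (N0 <= n)%N ->
  [/\ normc (b n n.-1) <= e * lam n, normc (b n n) <= e * lam n &
      normc (b n n.+1) <= e * lam n].

Lemma b_bound : exists2 C : R, 0 <= C & forall n,
  [/\ normc (b n n.-1) <= C * lam n, normc (b n n) <= C * lam n &
      normc (b n n.+1) <= C * lam n].
Proof.
have [N0 hN0] := b_small ltr01.
pose s n := (normc (b n n.-1) + normc (b n n) + normc (b n n.+1)) / lam n.
have s0 n : 0 <= s n by rewrite divr_ge0 ?addr_ge0 ?normc_ge0 ?lam_ge0.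
have S0 : 0 <= \sum_(n < N0) s n by exact: sumr_ge0.
exists (1 + \sum_(n < N0) s n); first by rewrite addr_ge0.
move=> n; have [nN0|N0n] := ltnP n N0; last first.
  have [h1 h2 h3] := hN0 n N0n.
  have h : 1 * lam n <= (1 + \sum_(n < N0) s n) * lam n.
    by rewrite ler_wpM2r ?lam_ge0// lerDl.
  by split; [apply: le_trans h1 _|apply: le_trans h2 _|apply: le_trans h3 _].
have h : s n * lam n <= (1 + \sum_(n < N0) s n) * lam n.
  rewrite ler_wpM2r ?lam_ge0// (bigD1 (Ordinal nN0))//=.
  by rewrite addrCA lerDl addr_ge0// sumr_ge0.
have e : s n * lam n = normc (b n n.-1) + normc (b n n) + normc (b n n.+1).
  by rewrite /s divfK// lt0r_neq0.
have := normc_ge0 (b n n.-1); have := normc_ge0 (b n n).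
have := normc_ge0 (b n n.+1) => p3 p2 p1.
by split; lra.
Qed.

Lemma Bcoef_small (e : R) : 0 < e -> exists N0, forall n, (N0 <= n)%N -> forall x,
  normc (Bcoef x n) <=
    e * lam n * (abs_coef x n.-1 + abs_coef x n + abs_coef x n.+1).
Proof.
move=> /b_small [N0 hN0]; exists N0 => n /hN0 [? ? ?] x.
exact: normc_Bcoef_le.
Qed.

Lemma Bcoef_bound : exists2 C : R, 0 <= C & forall n x,
  normc (Bcoef x n) <=
    C * lam n * (abs_coef x n.-1 + abs_coef x n + abs_coef x n.+1).
Proof.
have [C C0 hC] := b_bound; exists C => // n x.
by have [? ? ?] := hC n; exact: normc_Bcoef_le.
Qed.

(** [B] is infinitesimally small with respect to [A]: the finitely many rows
    where the entries exceed [e * lam n] are covered by the constant [C]. *)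
Lemma Bcoef_affine (e : R) : 0 < e -> exists2 C : R, 0 <= C & forall n x,
  normc (Bcoef x n) <=
    (e * lam n + C) * (abs_coef x n.-1 + abs_coef x n + abs_coef x n.+1).
Proof.
move=> e0; have [N0 hN0] := Bcoef_small e0; have [C C0 hC] := Bcoef_bound.
exists (C * lam N0); first by rewrite mulr_ge0 ?lam_ge0.
move=> n x; have m0 : 0 <= abs_coef x n.-1 + abs_coef x n + abs_coef x n.+1.
  by rewrite !addr_ge0 ?abs_coef_ge0.
have [nN0|N0n] := ltnP n N0.
  apply: le_trans (hC n x) _; rewrite ler_wpM2r// ler_wpDl//.
    by rewrite mulr_ge0 ?lam_ge0 ?ltW.
  by rewrite ler_wpM2l ?lam_le// ltnW.
apply: le_trans (hN0 n N0n x) _.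
by rewrite ler_wpM2r// lerDl mulr_ge0 ?lam_ge0.
Qed.

Lemma abs_coef_sq_bounded x : bounded_sums (fun n => abs_coef x n ^+ 2).
Proof. by exists (hnorm x ^+ 2) => N; exact: bessel. Qed.

Lemma weight_step (s : R) n :
  lam n `^ (2 * (s + 1)) = lam n ^+ 2 * lam n `^ (2 * s).
Proof.
rewrite mulrDr mulr1 powRD ?lt0r_neq0 ?implybT// mulrC powR_mulrn//.
exact: lam_ge0.
Qed.

Lemma weight_nd (s : R) n : 0 <= s -> lam n `^ s <= lam n.+1 `^ s.
Proof. by move=> s0; rewrite ge0_ler_powR ?nnegrE ?lam_ge0// lam_le. Qed.

Lemma weight_ratio (s : R) n : 0 <= s -> lam n.+1 `^ s <= L `^ s * lam n `^ s.
Proof.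
move=> s0; rewrite -powRM ?lam_ge0//.
by rewrite ge0_ler_powR ?nnegrE ?mulr_ge0 ?lam_ge0.
Qed.

Lemma Hs_mono (r s : R) x : r <= s -> Hs s x -> Hs r x.
Proof.
move=> rs /HsE h; apply/HsE.
pose c := (lam 0%N `^ (2 * (s - r)))^-1.
have c0 : 0 < lam 0%N `^ (2 * (s - r)) by rewrite powR_gt0.
have h' := bounded_sums_scale (ltW (_ : 0 < c)) h.
apply: bounded_sumsW (h' _) => [n|]; last by rewrite invr_gt0.
rewrite mulrA ler_wpM2r ?sqr_ge0// /c ler_pdivlMl//.
have -> : 2 * s = 2 * (s - r) + 2 * r by ring.
rewrite powRD ?lt0r_neq0 ?implybT// ler_wpM2r ?powR_ge0//.
by rewrite ge0_ler_powR ?nnegrE ?lam_ge0 ?lam_le// mulr_ge0// subr_ge0.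
Qed.

(** * Domains of powers of the perturbed operator *)

Section Closure.
Variables (u : R) (T : operator H).
Hypothesis clT : is_closure (perturb A B u) T.

Lemma closure_skew : skew_adjoint dot T.
Proof. exact: closure_skew_adjoint clT (qs_esa qs u). Qed.

Lemma domA_domT x : dom A x -> dom T x.
Proof. by move=> /(perturb_dom u) dx; have [] := closure_extends clT dx. Qed.

Lemma abs_coef_T_le x n : dom T x ->
  abs_coef (T x) n <= lam n * abs_coef x n + `|u| * normc (Bcoef x n).
Proof.
move=> dx; rewrite /abs_coef (coef_closure _ clT)//.
apply: le_trans (le_normcD _ _) _.
by rewrite normcN normc_ilam Normc.normcM normc_real.
Qed.

Lemma abs_coef_T_ge x n : dom T x ->
  lam n * abs_coef x n <= abs_coef (T x) n + `|u| * normc (Bcoef x n).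
Proof.
move=> dx; rewrite -normc_ilam -[in leLHS](opprK ('i%C * _ * _)) normcN.
have -> : - ('i%C * (lam n)%:C * coef x n) = coef (T x) n - u%:C * Bcoef x n.
  by rewrite (coef_closure _ clT)// addrK.
apply: le_trans (le_normcD _ _) _.
by rewrite normcN Normc.normcM normc_real.
Qed.

(** The analogue for [A] of [spectral_dom_succ], with the closure of [A + u B]
    in place of [A]. From left to right [A + u B] acts between the weighted
    spaces because neighbouring weights are comparable; the converse is
    [tridiagonal_regularity]. *)
Lemma Hs_succ (s : R) x : 0 <= s -> Hs (s + 1) x <-> dom T x /\ Hs s (T x).
Proof.
move=> s0; have s20 : 0 <= 2 * s by rewrite mulr_ge0.
have HE : Hs (s + 1) x <->
    bounded_sums (fun n => lam n ^+ 2 * lam n `^ (2 * s) * abs_coef x n ^+ 2).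
  by rewrite HsE; under eq_fun do rewrite weight_step.
split=> [h|[dx /HsE h]].
  have dx : dom T x by apply/domA_domT/Hs_domA; apply: Hs_mono h; lra.
  split=> //; apply/HsE; have [C C0 hC] := Bcoef_bound.
  move/HE : h => h.
  pose w n := lam n ^+ 2 * lam n `^ (2 * s).
  have w0 n : 0 <= w n by rewrite mulr_ge0 ?sqr_ge0 ?powR_ge0.
  have nb : bounded_sums (fun n =>
      w n * (abs_coef x n.-1 + abs_coef x n + abs_coef x n.+1) ^+ 2).
    have [M hM] := h; pose K := L `^ (2 * (s + 1)).
    exists (3 * (3 + K) * M) => N.
    have K0 : 0 <= K by exact: powR_ge0.
    apply: le_trans (sum_sq_neighbours (K := K) (abs_coef x) N w0 _ _ K0) _.
    - by move=> n; rewrite /w -!weight_step weight_nd//; lra.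
    - by move=> n; rewrite /w -!weight_step weight_ratio//; lra.
    - by rewrite ler_wpM2l// mulr_ge0//; lra.
  have cc : 0 <= 2 * (`|u| * C) ^+ 2 by rewrite mulr_ge0 ?sqr_ge0.
  have b2 := bounded_sums_scale (ler0n _ 2) h.
  apply: bounded_sumsW (bounded_sumsD b2 (bounded_sums_scale cc nb)) => n.
  set Z := _ + abs_coef x n.+1.
  have : abs_coef (T x) n <= lam n * abs_coef x n + `|u| * C * lam n * Z.
    apply: le_trans (abs_coef_T_le n dx) _; rewrite lerD2l -!mulrA ler_wpM2l//.
    by rewrite !mulrA hC.
  have := abs_coef_ge0 (T x) n; set y := abs_coef (T x) n.
  set p := _ * abs_coef x n.
  set q := _ * Z => y0 ypq.
  have y2 : y ^+ 2 <= 2 * p ^+ 2 + 2 * q ^+ 2.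
    apply: (@le_trans _ _ ((p + q) ^+ 2)).
      by rewrite lerXn2r ?nnegrE// (le_trans y0).
    by have := sqr_ge0 (p - q); nra.
  apply: le_trans (ler_wpM2l (powR_ge0 _ _) y2) _.
  rewrite le_eqVlt; apply/orP; left; apply/eqP.
  by rewrite /p /q /w; ring.
apply/HE; apply: (@tridiagonal_regularity R lam L lam_gt0
  (fun n => lam_le (leqnSn n)) lam_ratio L_ge0
  (fun n => lam n `^ (2 * s)) (abs_coef x) (abs_coef (T x))
  (L `^ (2 * s))) => //.
- by move=> n; exact: powR_ge0.
- by move=> n; exact: weight_nd.
- by move=> n; exact: weight_ratio.
- exact: powR_ge0.
- exact: abs_coef_ge0.
- exact: abs_coef_ge0.
- move=> e e0; have e' : 0 < e / (`|u| + 1) by rewrite divr_gt0// ltr_wpDl.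
  have [N0 hN0] := Bcoef_small e'; exists N0 => n nN0.
  apply: le_trans (abs_coef_T_ge n dx) _; rewrite lerD2l.
  have ht := hN0 n nN0 x; move: ht; set Z := _ + abs_coef x n.+1 => ht.
  have Z0 : 0 <= Z by rewrite !addr_ge0 ?abs_coef_ge0.
  apply: le_trans (ler_wpM2l (normr_ge0 u) ht) _.
  rewrite !mulrA ler_wpM2r// ler_wpM2r ?lam_ge0//.
  rewrite ler_pdivrMr; last by rewrite ltr_wpDl.
  by rewrite mulrC ler_wpM2l ?(ltW e0)// lerDl.
- exact: abs_coef_sq_bounded.
Qed.

Lemma domT_Hs x : dom T x <-> Hs 1 x.
Proof.
split=> [dx|/Hs_domA/domA_domT //]; rewrite -[1]add0r.
apply/Hs_succ => //; split => //; apply/HsE.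
apply: bounded_sumsW (abs_coef_sq_bounded (T x)) => n.
by rewrite mulr0 powRr0 mul1r.
Qed.


Lemma weight_half n : lam n `^ (2 * (1 / 2)) = lam n.
Proof. by rewrite mulrCA divff// mulr1 powRr1// lam_ge0. Qed.

Lemma HsE_half x : Hs (1 / 2) x <->
  bounded_sums (fun n => lam n * abs_coef x n ^+ 2).
Proof. by rewrite HsE; under eq_fun do rewrite weight_half. Qed.

Variable E : pvm dot.
Hypothesis specT : spectral_measure T E.
Local Notation moment := (moment E).

(** By Parseval, [- moment x] is the limit of the sums of
    [lam n * abs_coef x n ^+ 2] perturbed by the tri-diagonal terms, and by
    [Bcoef_affine] the perturbation is at most half of the main term plus a
    multiple of [`|x| ^+ 2]. *)
Lemma energy_bound : exists2 C : R, 0 <= C & forall x, dom T x ->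
  exists2 S : nat -> R, S @ \oo --> - moment x & forall N,
    `|S N - \sum_(n < N) lam n * abs_coef x n ^+ 2| <=
    2^-1 * (\sum_(n < N.+1) lam n * abs_coef x n ^+ 2) + C * hnorm x ^+ 2.
Proof.
pose K := 1 + L; have K0 : 0 <= K by rewrite addr_ge0.
(* Summing the neighbouring terms costs a factor [3 * (3 + K)], so that they use
   up one half of the energy. *)
pose e := (6 * (3 + K))^-1.
have e0 : 0 < e by rewrite invr_gt0; lra.
have e'0 : 0 < e / (`|u| + 1) by rewrite divr_gt0// ltr_wpDl.
have [C1 C10 hC1] := Bcoef_affine e'0; pose C2 := `|u| * C1.
have C20 : 0 <= C2 by rewrite mulr_ge0.
exists (3 * (3 + K) * C2) => [|x dx]; first by rewrite !mulr_ge0//; lra.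
pose r n := Re (conjc (coef x n) * ('i%C * (u%:C * Bcoef x n))).
exists (fun N => \sum_(n < N) (lam n * abs_coef x n ^+ 2 + r n)).
  have := parseval_Re hilb basis (x := x) (y := 'i%C *: T x).
  rewrite ipZr -(Im_ip_op specT dx).
  have -> : Re ('i%C * ip x (T x)) = - Im (ip x (T x)).
    by case: (ip x (T x)) => a c /=; ring.
  have e1 n : Re (conjc (coef x n) * coef ('i%C *: T x) n) =
      lam n * abs_coef x n ^+ 2 + r n.
    have -> : coef ('i%C *: T x) n = 'i%C * coef (T x) n by exact: ipZr.
    rewrite (coef_closure _ clT)// mulrDr mulrDr ReD /r; congr (_ + _).
    have -> : conjc (coef x n) * ('i%C * - ('i%C * (lam n)%:C * coef x n)) =
        (lam n * abs_coef x n ^+ 2)%:C.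
      have i2 : 'i%C * 'i%C = -1 :> R[i] by rewrite -expr2 sqr_i.
      rewrite [RHS](_ : _ = (lam n)%:C * (coef x n * conjc (coef x n))); last first.
        by rewrite mulcJ -[LHS]/(real_complex R _) rmorphM.
      transitivity (- ('i%C * 'i%C) * (lam n)%:C * (coef x n * conjc (coef x n))).
        by ring.
      by rewrite i2 opprK mul1r.
    by [].
  by under eq_fun do under eq_bigr do rewrite e1.
move=> N; rewrite -sumrB.
under eq_bigr do rewrite addrAC subrr add0r.
apply: le_trans (ler_norm_sum _ _ _) _.
pose w n := e * lam n + C2.
have w0 n : 0 <= w n by rewrite addr_ge0// mulr_ge0 ?lam_ge0// ltW.
pose Z n := abs_coef x n.-1 + abs_coef x n + abs_coef x n.+1.
have Z0 n : 0 <= Z n by rewrite !addr_ge0 ?abs_coef_ge0.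
have rw n : `|r n| <= w n * Z n ^+ 2.
  apply: le_trans (Re_le_normc _) _.
  rewrite Normc.normcM normc_conj -/(abs_coef x n).
  have -> : normc ('i%C * (u%:C * Bcoef x n)) = `|u| * normc (Bcoef x n).
    by rewrite !Normc.normcM normc_real /= expr0n expr1n add0r sqrtr1 mul1r.
  rewrite mulrC expr2 [leRHS]mulrA.
  rewrite ler_pM ?abs_coef_ge0 ?mulr_ge0 ?normc_ge0//; last first.
    by rewrite /Z addrAC lerDr addr_ge0 ?abs_coef_ge0.
  apply: le_trans (ler_wpM2l (normr_ge0 u) (hC1 n x)) _.
  rewrite -/(Z n) mulrA ler_wpM2r// mulrDr lerD2r mulrA ler_wpM2r ?lam_ge0//.
  rewrite mulrA ler_pdivrMr; last by rewrite ltr_wpDl.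
  by rewrite mulrC ler_wpM2l ?(ltW e0)// lerDl.
apply: (@le_trans _ _ (\sum_(n < N) w n * Z n ^+ 2)).
  by apply: ler_sum => n _; exact: rw.
have wS n : w n <= w n.+1.
  by rewrite lerD2r ler_wpM2l ?(ltW e0)// lam_le.
have wK n : w n.+1 <= K * w n.
  have h : e * lam n.+1 <= L * (e * lam n).
    by rewrite mulrCA ler_wpM2l// ltW.
  have p0 : 0 <= e * lam n by rewrite mulr_ge0 ?lam_ge0// ltW.
  have q0 : 0 <= L * C2 by rewrite mulr_ge0.
  by rewrite /w /K mulrDl mul1r mulrDr; lra.
apply: le_trans (sum_sq_neighbours (abs_coef x) N w0 wS wK K0) _.
have -> : \sum_(n < N.+1) w n * abs_coef x n ^+ 2 =
    e * (\sum_(n < N.+1) lam n * abs_coef x n ^+ 2) +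
    C2 * \sum_(n < N.+1) abs_coef x n ^+ 2.
  rewrite !mulr_sumr -big_split; apply: eq_bigr => n _ /=.
  by rewrite /w mulrDl -mulrA.
rewrite mulrDr lerD//.
  rewrite mulrA ler_wpM2r//.
    by rewrite sumr_ge0// => n _; rewrite mulr_ge0 ?lam_ge0 ?sqr_ge0.
  have -> : 3 * (3 + K) * e = 2^-1 by rewrite /e; field; apply/negP => /eqP; lra.
  by [].
rewrite mulrA ler_wpM2l ?bessel//.
by rewrite !mulr_ge0//; lra.
Qed.

Lemma energy_ge : exists2 C : R, 0 <= C & forall x, dom T x -> forall N,
  \sum_(n < N) lam n * abs_coef x n ^+ 2 <= - 2 * moment x + C * hnorm x ^+ 2.
Proof.
have [C C0 hC] := energy_bound.
exists (2 * C) => [|x dx N]; first by rewrite mulr_ge0.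
have [S Sm hS] := hC x dx.
pose Ls N := \sum_(n < N) lam n * abs_coef x n ^+ 2.
have p n : 0 <= lam n * abs_coef x n ^+ 2 by rewrite mulr_ge0 ?lam_ge0 ?sqr_ge0.
have Lnd : nondecreasing_seq Ls.
  by move=> m n mn; apply: (sum_le_more (u := fun n => lam n * abs_coef x n ^+ 2)).
have [M hM] : bounded_sums (fun n => lam n * abs_coef x n ^+ 2).
  apply/HsE_half; apply: Hs_mono (_ : Hs 1 x); first lra.
  exact/domT_Hs.
have Lcv : cvgn Ls.
  by apply: nondecreasing_is_cvgn => //; exists M => _ [n _ <-]; exact: hM.
apply: le_trans (nondecreasing_cvgn_le Lnd Lcv N) _; set l := limn Ls.
have LS : (fun n => Ls n.+1) @ \oo --> l by rewrite cvg_shiftS.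
have h : (fun n => S n + (2^-1 * Ls n.+1 + C * hnorm x ^+ 2)) @ \oo -->
    - moment x + (2^-1 * l + C * hnorm x ^+ 2).
  by apply: cvgD => //; apply: cvgD; [exact: cvgMr|exact: cvg_cst].
have : l <= - moment x + (2^-1 * l + C * hnorm x ^+ 2).
  apply: (ler_cvg_to Lcv h); apply: nearW => n.
  by have := hS n; rewrite ler_norml -/(Ls n) -/(Ls n.+1) => /andP[]; lra.
by lra.
Qed.

Lemma energy_le : exists2 C : R, 0 <= C & forall x (M : R), dom T x ->
  (forall N, \sum_(n < N) lam n * abs_coef x n ^+ 2 <= M) ->
  - moment x <= 2 * M + C * hnorm x ^+ 2.
Proof.
have [C C0 hC] := energy_bound; exists C => // x M dx hM.
have [S Sm hS] := hC x dx.
have M0 : 0 <= M by have := hM 0%N; rewrite big_ord0.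
apply: (cvgr_to_le Sm); apply: nearW => n.
have := hS n; rewrite ler_norml => /andP[_].
by have := hM n; have := hM n.+1; lra.
Qed.

(** On the domain of [T] the form [- moment] is equivalent, up to multiples of
    [`|x| ^+ 2], to the form of [`|A|] ([energy_ge] and [energy_le]), and also
    to that of [`|T|], since it is bounded below. Both form domains are then
    reached by approximation from the domain of [T]: spectral cut-offs in one
    direction, Fourier sums in the other. The bounds are uniform and each
    finite sum is continuous, so that they survive the limit. *)
Lemma half_power x : spectral_dom_abs_pow E (1 / 2) x <-> Hs (1 / 2) x.
Proof.
have [C1 C10 hC1] := energy_ge; have [C2 C20 hC2] := energy_le.
have sq_le y z : hnorm y <= hnorm z -> hnorm y ^+ 2 <= hnorm z ^+ 2.
  by move=> yz; rewrite lerXn2r ?nnegrE ?hnorm_ge0.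
split=> [/(spectral_half_approx hilb specT)[M [f fx hf]]|/HsE_half [M hM]].
  apply/HsE_half; exists (2 * M + C1 * hnorm x ^+ 2) => N.
  have cv : (fun m => \sum_(n < N) lam n * abs_coef (f m) n ^+ 2) @ \oo -->
      \sum_(n < N) lam n * abs_coef x n ^+ 2.
    apply: (cvg_sum_ord (F := fun n m => lam n * abs_coef (f m) n ^+ 2)
      (a := fun n => lam n * abs_coef x n ^+ 2)) => n; apply: cvgMr.
    have h := hcvg_normc_ip hilb (y := phi n) fx.
    by rewrite expr2; under eq_fun do rewrite expr2; exact: cvgM.
  apply: (cvgr_to_le cv); apply: nearW => m; have [d1 d2 d3] := hf m.
  apply: le_trans (hC1 _ d1 N) _; apply: lerD; first by lra.
  by rewrite ler_wpM2l// sq_le.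
apply/(spectral_dom_series hilb); first by lra.
have b0 := bounded_shells hilb E x.
suff b1 : bounded_sums (fun n => n%:R * hnorm (pvm_E E (shell n) x) ^+ 2).
  apply: bounded_sumsW (bounded_sumsD b1 b0) => n.
  have -> : 2 * (1 / 2) = 1 :> R by lra.
  by rewrite powRr1// -[n.+1%:R]natr1 mulrDl mul1r.
have bnd z : dom T z -> moment z <= C1 / 2 * hnorm z ^+ 2.
  by move=> dz; have := hC1 z dz 0%N; rewrite big_ord0; lra.
pose f := psum (coef x).
have fx : hcvg f x by exact: psum_coef_cvg.
have df m : dom T (f m) by apply: domA_domT; exact: psum_domA.
have fle m : hnorm (f m) ^+ 2 <= hnorm x ^+ 2.
  by rewrite (hnorm_psum hilb basis); exact: bessel.
have hf m N : \sum_(n < N) lam n * abs_coef (f m) n ^+ 2 <= M.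
  apply: le_trans (hM N); apply: ler_sum => n _.
  rewrite ler_wpM2l ?lam_ge0// /abs_coef (coef_psum basis); case: ifP => // _.
  by rewrite Normc.normc0 expr0n sqr_ge0.
exists (2 * M + C2 * hnorm x ^+ 2 + 2 * (C1 / 2) * hnorm x ^+ 2) => N.
have cv : (fun m => \sum_(n < N) n%:R * hnorm (pvm_E E (shell n) (f m)) ^+ 2) @ \oo -->
    \sum_(n < N) n%:R * hnorm (pvm_E E (shell n) x) ^+ 2.
  apply: (cvg_sum_ord
    (F := fun n m => n%:R * hnorm (pvm_E E (shell n) (f m)) ^+ 2)
    (a := fun n => n%:R * hnorm (pvm_E E (shell n) x) ^+ 2)) => n; apply: cvgMr.
  have Ef : hcvg (fun m => pvm_E E (shell n) (f m)) (pvm_E E (shell n) x).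
    apply: (cvg_dominated _ fx) => m; rewrite subr0 ger0_norm ?hnorm_ge0//.
    have mS := @measurable_shell R n.
    by rewrite -(pvmB E _ _ mS); exact: hnorm_pvm_le.
  have h := hcvg_norm Ef.
  by rewrite expr2; under eq_fun do rewrite expr2; exact: cvgM.
apply: (cvgr_to_le cv); apply: nearW => m.
have C12 : 0 <= C1 / 2 by rewrite divr_ge0.
apply: le_trans (sum_shells_le_moment hilb specT C12 bnd (df m) N) _.
apply: lerD; last by rewrite ler_wpM2l// mulr_ge0.
apply: le_trans (hC2 _ _ (df m) (hf m)) _; rewrite lerD2l ler_wpM2l//.
Qed.

(** Exponents [0] and [1 / 2] start two inductions with step [1], driven by
    [spectral_dom_succ] and [Hs_succ]. *)
Lemma power_dom (m : nat) x :
  spectral_dom_abs_pow E (m%:R / 2) x <-> Hs (m%:R / 2) x.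
Proof.
have step s : 0 <= s ->
    (forall x, spectral_dom_abs_pow E s x <-> Hs s x) ->
    forall x, spectral_dom_abs_pow E (s + 1) x <-> Hs (s + 1) x.
  move=> s0 IH y; rewrite (Hs_succ _ s0).
  rewrite (spectral_dom_succ hilb specT _ closure_skew.1 y s0) ?IH//.
  by move=> z w; exact: (skew_adjoint_skew closure_skew).
suff : (forall x, spectral_dom_abs_pow E (m%:R / 2) x <-> Hs (m%:R / 2) x) /\
  (forall x, spectral_dom_abs_pow E (m.+1%:R / 2) x <-> Hs (m.+1%:R / 2) x).
  by case=> + _; exact.
elim: m {x} => [|m [IH1 IH2]]; split => //.
- rewrite mul0r => x; split=> _.
    apply/HsE; apply: bounded_sumsW (abs_coef_sq_bounded x) => n.
    by rewrite mulr0 powRr0 mul1r.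
  apply/(spectral_dom_series hilb) => //.
  apply: bounded_sumsW (bounded_shells hilb E x) => n.
  by rewrite mulr0 powRr0 mul1r.
- exact: half_power.
- have -> : m.+2%:R / 2 = m%:R / 2 + 1 :> R.
    by rewrite -addn2 natrD mulrDl divff.
  by apply: step => //; rewrite divr_ge0.
Qed.

End Closure.

(** * The coupling constant *)

Lemma abs_pow_coef (s : R) x : Hs s x ->
  coef (abs_pow dot lam phi s x) =1 fun n => (lam n `^ s)%:C * coef x n.
Proof.
move=> /HsE h; set c := fun n : nat => _.
have [z zc coefz] : exists2 z, hcvg (psum c) z & coef z =1 c.
  apply: (riesz_fischer hilb basis); apply: bounded_sumsW h => n.
  rewrite /c Normc.normcM normc_real ger0_norm ?powR_ge0// exprMn.
  have -> : (lam n `^ s) ^+ 2 = lam n `^ (2 * s).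
    by rewrite -powR_mulrn ?powR_ge0// -powRrM mulrC.
  by [].
suff -> : abs_pow dot lam phi s x = z by [].
by apply: cvg_lim; [exact: norm_hausdorff|exact: hcvg_cvg].
Qed.

Definition cross x n : R := Re (conjc (coef x n) * (b n n.+1 * coef x n.+1)).

Lemma Re_diag x n : Re (conjc (coef x n) * (b n n * coef x n)) = 0.
Proof.
have : Re (b n n) = 0.
  by have := congr1 (@complex.Re R) (b_skew n n); rewrite ReN ReJ; lra.
rewrite mulrCA [conjc _ * _]mulrC mulcJ.
by case: (b n n) => a c /= ->; rewrite mul0r mulr0 subr0.
Qed.

Lemma Re_Bcoef0 x : Re (conjc (coef x 0) * Bcoef x 0) = cross x 0.
Proof. by rewrite Bcoef0 mulrDr ReD Re_diag add0r. Qed.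

Lemma Re_BcoefS x n :
  Re (conjc (coef x n.+1) * Bcoef x n.+1) = cross x n.+1 - cross x n.
Proof.
rewrite BcoefS !mulrDr !ReD Re_diag addr0 addrC; congr (_ + _).
rewrite /cross (b_skew n n.+1) -ReN -[RHS]ReJ; congr Re.
by rewrite rmorphN !rmorphM /= !conjcK; ring.
Qed.

(** The diagonal of [B] is imaginary and its two off-diagonals are opposite
    conjugates, so the [n]-th summand is [w n * (cross x n - cross x n.-1)]
    for [n > 0]; summation by parts then replaces the weights by their increments. *)
Lemma abel_cross x (w : nat -> R) N :
  \sum_(n < N.+1) w n * Re (conjc (coef x n) * Bcoef x n) =
  w N * cross x N - \sum_(n < N) (w n.+1 - w n) * cross x n.
Proof.
elim: N => [|N IH].
  by rewrite big_ord_recr !big_ord0 /= add0r Re_Bcoef0 subr0.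
by rewrite big_ord_recr IH [in RHS]big_ord_recr /= Re_BcoefS; ring.
Qed.

Lemma cross_le x n :
  `|cross x n| <= normc (b n n.+1) * (abs_coef x n * abs_coef x n.+1).
Proof.
apply: le_trans (Re_le_normc _) _.
by rewrite !Normc.normcM normc_conj mulrCA.
Qed.

(** By [abel_cross] with the weights [lam n ^+ k], the real part of
    [<|A|^k x, B x>] is a sum of [(lam n.+1 ^+ k - lam n ^+ k) * cross x n] plus
    a boundary term. Each summand is at most
    [S * lam n ^+ k * abs_coef x n * abs_coef x n.+1], hence, the weights being
    nondecreasing, half the sum of two consecutive terms of
    [<|A|^k x, x>] times [S]. The boundary term tends to [0] because [x] lies in
    the domain of [|A|^k] and [k + 1 <= 2 * k]. *)
Lemma coupling_bound (k : nat) (S : R) x : (0 < k)%N ->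
  (forall n, normc (b n n.+1) * (lam n.+1 ^+ k / lam n ^+ k - 1) <= S) ->
  Hs k%:R x ->
  `|Re (ip (abs_pow dot lam phi k%:R x) (B x))| <=
  S * Re (ip (abs_pow dot lam phi k%:R x) x).
Proof.
move=> k0 hS hx; set z := abs_pow _ _ _ _ _.
have zE : coef z =1 fun n => (lam n `^ k%:R)%:C * coef x n by exact: abs_pow_coef.
have dx : dom A x.
  by apply: Hs_domA; apply: Hs_mono hx; rewrite ler1n.
pose w n := lam n ^+ k.
have w_gt0 n : 0 < w n by rewrite exprn_gt0.
have wS n : w n <= w n.+1 by rewrite lerXn2r ?nnegrE ?lam_ge0// lam_le.
have zn n (y : R[i]) : Re (conjc (coef z n) * y) = w n * Re (conjc (coef x n) * y).
  rewrite zE powR_mulrn ?lam_ge0// rmorphM -/(w n).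
  rewrite [X in X * _ * _](conjc_real (w n)) -mulrA.
  by case: (_ * y) => a c /=; rewrite mul0r subr0.
have cvB : (fun N => \sum_(n < N) w n * Re (conjc (coef x n) * Bcoef x n)) @ \oo -->
    Re (ip z (B x)).
  have := parseval_Re hilb basis (x := z) (y := B x).
  by under eq_fun do under eq_bigr do rewrite coef_B// zn.
pose G N := \sum_(n < N) w n * abs_coef x n ^+ 2.
have cvG : G @ \oo --> Re (ip z x).
  have := parseval_Re hilb basis (x := z) (y := x).
  by under eq_fun do under eq_bigr do rewrite zn [conjc _ * _]mulrC mulcJ /=.
have G0 n : 0 <= w n * abs_coef x n ^+ 2 by rewrite mulr_ge0 ?sqr_ge0 ?ltW.
have S0 : 0 <= S.
  apply: le_trans (hS 0%N); rewrite mulr_ge0 ?normc_ge0// subr_ge0.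
  by rewrite ler_pdivlMr ?mul1r ?exprn_gt0//; exact: wS.
have [C C0 hC] := b_bound.
pose a n := lam n `^ (2 * k%:R) * abs_coef x n ^+ 2.
have a0 n : 0 <= a n by rewrite mulr_ge0 ?powR_ge0 ?sqr_ge0.
have acv : a @ \oo --> (0 : R) by apply: bounded_sums_cvg0 => //; exact/HsE.
(* [lam n <= lam n ^+ k / lam 0 ^+ k.-1] turns the bound [C * lam n] on the
   entries of [B] into a bound by [D * lam n ^+ k]. *)
pose D := C / (lam 0%N ^+ k.-1).
have D0 : 0 <= D by rewrite divr_ge0// exprn_ge0// lam_ge0.
have boundary n : `|w n * cross x n| <= D * (a n + a n.+1).
  rewrite normrM (gtr0_norm (w_gt0 n)).
  have [_ _ hb] := hC n.
  have aE m : a m = (w m * abs_coef x m) ^+ 2.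
    rewrite exprMn /a mulrC -natrM powR_mulrn ?lam_ge0// mulrC -exprM.
    by rewrite mulnC.
  have h1 : w n * `|cross x n| <=
      w n * (C * lam n * (abs_coef x n * abs_coef x n.+1)).
    rewrite ler_wpM2l ?(ltW (w_gt0 n))//; apply: le_trans (cross_le x n) _.
    by rewrite ler_wpM2r// mulr_ge0 ?abs_coef_ge0.
  apply: le_trans h1 _.
  have lw : lam n <= w n / lam 0%N ^+ k.-1.
    rewrite ler_pdivlMr ?exprn_gt0// /w.
    rewrite -[in leRHS](prednK k0) exprS.
    by rewrite ler_wpM2l ?lam_ge0// lerXn2r ?nnegrE ?lam_ge0// lam_le.
  have h2 : w n * (C * lam n * (abs_coef x n * abs_coef x n.+1)) <=
      D * ((w n * abs_coef x n) * (w n.+1 * abs_coef x n.+1)).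
    apply: (@le_trans _ _ (w n * (C * (w n / lam 0%N ^+ k.-1) *
        (abs_coef x n * abs_coef x n.+1)))).
      rewrite ler_wpM2l ?(ltW (w_gt0 n))//.
      by rewrite ler_wpM2r ?mulr_ge0 ?abs_coef_ge0// ler_wpM2l.
    rewrite [leLHS](_ : _ =
      D * ((w n * abs_coef x n) * (w n * abs_coef x n.+1))); last first.
      by rewrite /D; ring.
    rewrite ler_wpM2l// ler_wpM2l ?mulr_ge0 ?abs_coef_ge0 ?(ltW (w_gt0 n))//.
    by rewrite ler_wpM2r ?abs_coef_ge0.
  apply: le_trans h2 _; rewrite ler_wpM2l// !aE.
  set p := w n * _; set q := w n.+1 * _.
  by have := sqr_ge0 (p - q); have := sqr_ge0 (p + q); nra.
have main N : `|\sum_(n < N.+1) w n * Re (conjc (coef x n) * Bcoef x n)| <=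
    D * (a N + a N.+1) + S * G N.+1.
  rewrite abel_cross; apply: le_trans (ler_normB _ _) _; apply: lerD => //.
  apply: le_trans (ler_norm_sum _ _ _) _.
  apply: (@le_trans _ _ (\sum_(n < N) S * (2^-1 * (w n * abs_coef x n ^+ 2) +
      2^-1 * (w n.+1 * abs_coef x n.+1 ^+ 2)))).
    apply: ler_sum => n _; rewrite normrM ger0_norm ?subr_ge0//.
    have d0 : 0 <= w n.+1 - w n by rewrite subr_ge0.
    apply: le_trans (ler_wpM2l d0 (cross_le x n)) _.
    have -> : (w n.+1 - w n) * (normc (b n n.+1) * (abs_coef x n * abs_coef x n.+1)) =
       normc (b n n.+1) * (w n.+1 / w n - 1) *
       (w n * (abs_coef x n * abs_coef x n.+1)).
      by field; rewrite lt0r_neq0.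
    apply: le_trans (ler_wpM2r _ (hS n)) _.
      by rewrite !mulr_ge0 ?abs_coef_ge0 ?(ltW (w_gt0 n)).
    rewrite ler_wpM2l//.
    apply: (@le_trans _ _ (2^-1 * (w n * abs_coef x n ^+ 2) +
        2^-1 * (w n * abs_coef x n.+1 ^+ 2))).
      rewrite -2!mulrDr [leRHS]mulrCA ler_wpM2l ?(ltW (w_gt0 n))//.
      set p := abs_coef x n; set q := abs_coef x n.+1.
      by have := sqr_ge0 (p - q); nra.
    by rewrite lerD2l ler_wpM2l// ler_wpM2r ?sqr_ge0.
  rewrite -mulr_sumr ler_wpM2l// big_split /= -!mulr_sumr.
  have g1 : \sum_(n < N) w n * abs_coef x n ^+ 2 <= G N.+1.
    exact: (sum_le_more (u := fun n => w n * abs_coef x n ^+ 2)).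
  have g2 : \sum_(n < N) w n.+1 * abs_coef x n.+1 ^+ 2 <= G N.+1.
    by rewrite /G big_ord_recl /= lerDr.
  by lra.
have cv1 : (fun N => `|\sum_(n < N.+1) w n * Re (conjc (coef x n) * Bcoef x n)|) @ \oo -->
    `|Re (ip z (B x))|.
  by apply: cvg_norm; move: cvB; rewrite -cvg_shiftS.
have cv2 : (fun N => D * (a N + a N.+1) + S * G N.+1) @ \oo -->
    D * (0 + 0) + S * Re (ip z x).
  apply: cvgD; apply: cvgMr; last by move: cvG; rewrite -cvg_shiftS.
  by apply: cvgD => //; move: acv; rewrite -cvg_shiftS.
have h := ler_cvg_to cv1 cv2 (nearW _ main).
rewrite addr0 mulr0 add0r in h.
exact: h.
Qed.

End System.

(** * The hypotheses on the ratios and the conclusion *)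

Lemma bounded_fun_ex (R : realType) (f : nat -> R) :
  bounded_fun f -> exists M, forall n, `|f n| <= M.
Proof.
move=> [M [_ hM]]; exists (M + 1) => n; apply: (hM (M + 1)) => //.
by rewrite ltrDl.
Qed.

Lemma cvg0_ratio (R : realType) (z : nat -> R[i]) (r : nat -> R) (e : R) :
  (forall n, 0 < r n) -> (fun n => z n / (r n)%:C) @ \oo --> (0 : R[i]^o) ->
  0 < e -> exists N, forall n, (N <= n)%N -> Normc.normc (z n) <= e * r n.
Proof.
move=> r0 /(@cvgrPdist_lt _ R[i]^o) h e0; have e0' : 0 < e%:C by rewrite ltcR.
have [N _ hN] := h _ e0'; exists N => n /hN /=.
rewrite sub0r normrN normrE_normc ltcR Normc.normcM Normc.normcV normc_real.
rewrite gtr0_norm ?r0// => /ltW.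
by rewrite ler_pdivrMr ?r0.
Qed.

Theorem proposition10 (R : realType) (H : completeNormedModType R[i])
  (dot : {dot H for Num.conj}) (A B : operator H)
  (lam : nat -> R) (phi : nat -> H) (k : nat)
  (b := coupling dot B phi) :
  is_hilbert dot ->
  separable_space H ->
  tri_diagonal_system dot A B lam phi ->
  (0 < k)%N ->
  bounded_fun (fun n : nat => lam n.+1 / lam n) ->
  (fun n : nat => b n.+1 n / (lam n.+1)%:C) @ \oo --> (0 : R[i]^o) ->
  (fun n : nat => b n n / (lam n)%:C) @ \oo --> (0 : R[i]^o) ->
  bounded_fun (fun n : nat =>
    Normc.normc (b n n.+1) * (lam n.+1 ^+ k / lam n ^+ k - 1)) ->
  weakly_coupled dot A B lam phi k%:R /\
  (coupling_constant dot B lam phi k%:R <=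
   ereal_sup (range (fun n : nat =>
     (Normc.normc (b n n.+1) * (lam n.+1 ^+ k / lam n ^+ k - 1))%:E)))%E.
Proof.
move=> hilb _ sys k0 /bounded_fun_ex[L hL] off diag /bounded_fun_ex[M hM].
have lam0 := qs_lam_gt0 sys.1.
have L0 : 0 <= L by apply: le_trans (hL 0%N).
have ratio n : lam n.+1 <= L * lam n.
  by rewrite -ler_pdivrMr//; apply: le_trans (hL n); exact: ler_norm.
have small (e : R) : 0 < e -> exists N0, forall n, (N0 <= n)%N ->
  [/\ Normc.normc (b n n.-1) <= e * lam n, Normc.normc (b n n) <= e * lam n &
      Normc.normc (b n n.+1) <= e * lam n].
  (* The entry above the diagonal is compared with the next eigenvalue, which
     costs the factor [L]. *)
  move=> e0; have e1 : 0 < e / (L + 1) by rewrite divr_gt0// ltr_wpDl.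
  have e1e : e / (L + 1) <= e.
    by rewrite ler_pdivrMr ?ltr_wpDl// mulrDr mulr1 lerDr mulr_ge0// ltW.
  have e1L : e / (L + 1) * L <= e.
    by rewrite mulrAC ler_pdivrMr ?ltr_wpDl// mulrDr mulr1 lerDl ltW.
  have [N1 h1] := cvg0_ratio (fun n => lam0 n.+1) off e1.
  have [N2 h2] := cvg0_ratio lam0 diag e0.
  exists (maxn N1 N2).+1 => -[//|n] nN; have nN1 : (N1 <= n)%N by lia.
  split.
  - by apply: le_trans (h1 n nN1) _; rewrite ler_wpM2r// ltW.
  - by apply: h2; lia.
  - rewrite (normc_b_sym sys); apply: le_trans (h1 n.+1 _) _; first lia.
    apply: le_trans (ler_wpM2l (ltW e1) (ratio n.+1)) _.
    by rewrite mulrA ler_wpM2r// ltW.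
have bound := coupling_bound hilb sys small k0.
have Re_le (S r : R) (z : R[i]) : 0 <= S -> r <= S * complex.Re z ->
    r <= S * Normc.normc z.
  move=> S0 h; apply: le_trans h _; rewrite ler_wpM2l//.
  exact: le_trans (ler_norm _) (Re_le_normc _).
have term0 n : 0 <= Normc.normc (b n n.+1) * (lam n.+1 ^+ k / lam n ^+ k - 1).
  rewrite mulr_ge0 ?normc_ge0// subr_ge0 ler_pdivlMr ?exprn_gt0// mul1r.
  by rewrite lerXn2r ?nnegrE ?(ltW (lam0 _))//; exact: (qs_lam_nd sys.1).
split; first split.
- move=> u T E clT specT; apply/seteqP; split => x.
    by move=> /(power_dom hilb sys L0 ratio small clT specT).
  by move=> /(power_dom hilb sys L0 ratio small clT specT).
- exists M => x hx; apply: Re_le; first exact: le_trans (hM 0%N).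
  by apply: bound => // n; apply: le_trans (hM n); exact: ler_norm.
set s := ereal_sup _.
have s_ge n : ((Normc.normc (b n n.+1) * (lam n.+1 ^+ k / lam n ^+ k - 1))%:E <= s)%E.
  by apply: ereal_sup_ubound; exists n.
have s_le : (s <= M%:E)%E.
  apply: ge_ereal_sup => _ [n _ <-]; rewrite lee_fin.
  by apply: le_trans (hM n); exact: ler_norm.
have s_fin : s \is a fin_num.
  rewrite fin_numE; apply/andP; split.
    by apply/eqP => sE; have := s_ge 0%N; rewrite sE.
  by apply/eqP => sE; move: s_le; rewrite sE.
have s_ge' n : Normc.normc (b n n.+1) * (lam n.+1 ^+ k / lam n ^+ k - 1) <= fine s.
  by rewrite -lee_fin fineK.
have s0 : 0 <= fine s by apply: le_trans (s_ge' 0%N).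
apply: ge_ereal_sup => _ [x [hx _] <-].
rewrite -(fineK s_fin) lee_fin.
have h := Re_le _ _ _ s0 (bound _ x s_ge' hx).
have [->|z0] := eqVneq (Normc.normc (inner dot (abs_pow dot lam phi k%:R x) x)) 0.
  by rewrite invr0 mulr0.
by rewrite ler_pdivrMr// lt_neqAle eq_sym z0 normc_ge0.
Qed.
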